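(* Let $Q=(X,E,r,s,\lambda)$ and $Q'=(X',E',r',s',\lambda')$ be topological quivers. Suppose $Q\cong Q'$, i.e. there are a homeomorphism $\varphi:X\to X'$, a measurable homeomorphism $\psi:E\to E'$ and a family of constants $\{h_y>0 : y\in X\}$ such that $\varphi(s(e))=s'(\psi(e))$, $\varphi(r(e))=r'(\psi(e))$ and $\lambda'_{\varphi(y)}(B)=\int_B h_y\,d(\lambda_y\circ\psi^{-1})$ for each $e\in E$, each measurable $B\subseteq E'$ and each $y\in X$. Then $\mathcal T(Q)\cong\mathcal T(Q')$ and $C^*(Q)\cong C^*(Q')$.
   Context: A topological quiver $Q=(X,E,r,s,\lambda)$ consists of second countable locally compact Hausdorff spaces $X$ and $E$, continuous maps $r,s:E\to X$ with $r$ open, and a family $\lambda=\{\lambda_y\}_{y\in X}$ of Radon measures on $E$ such that $\operatorname{supp}\lambda_y=r^{-1}(y)$ for all $y\in X$ and, for each $f\in C_c(E)$, the function $y\mapsto\int_E f\,d\lambda_y$ lies in $C_c(X)$. The $C^*$-correspondence $\mathcal E_Q$ over $A=C_0(X)$ is the completion of $C_c(E)$ for the norm $\|\xi\|=\|\langle\xi,\xi\rangle\|_\infty^{1/2}$, where $\langle\xi,\eta\rangle(y)=\int_{r^{-1}(y)}\overline{\xi}\,\eta\,d\lambda_y$, with left and right actions $(a\cdot\xi\cdot b)(e)=a(s(e))\xi(e)b(r(e))$; the left action is the $*$-homomorphism $\phi:A\to\mathcal L(\mathcal E_Q)$, $\phi(a)\xi=a\cdot\xi$. For a $C^*$-correspondence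 $\mathcal E$ over $A$ with left action $\phi$: a representation $(T,\pi)$ of $\mathcal E$ in a $C^*$-algebra $B$ is a linear map $T:\mathcal E\to B$ and a $*$-homomorphism $\pi:A\to B$ with $T(\xi)^*T(\eta)=\pi(\langle\xi,\eta\rangle)$ and $T(\phi(a)\xi)=\pi(a)T(\xi)$. It induces $\Psi_T:\mathcal K(\mathcal E)\to B$, $\Psi_T(\theta_{\xi,\eta})=T(\xi)T(\eta)^*$, where $\theta_{\xi,\eta}(\zeta)=\xi\langle\eta,\zeta\rangle$ and $\mathcal K(\mathcal E)$ is the closed span of the $\theta_{\xi,\eta}$. Put $J(\mathcal E)=\phi^{-1}(\mathcal K(\mathcal E))$ and $J_{\mathcal E}=J(\mathcal E)\cap(\ker\phi)^\perp$, where $(\ker\phi)^\perp=\{a\in A: ab=0\ \forall b\in\ker\phi\}$. For a closed ideal $K$ of $J(\mathcal E)$, $(T,\pi)$ is coisometric on $K$ if $\Psi_T(\phi(a))=\pi(a)$ for all $a\in K$. The relative Cuntz-Pimsner algebra $\mathcal O(K,\mathcal E)$ is the $C^*$-algebra generated by the universal representation coisometric on $K$. Then $\mathcal T(Q):=\mathcal O(0,\mathcal E_Q)$ (Toeplitz-Pimsner algebra) and $C^*(Q):=\mathcal O(J_{\mathcal E_Q},\mathcal E_Q)$ (Cuntz-Pimsner algebra). *)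

(* Defs.v *)
From HB Require Import structures.
From mathcomp Require Import all_boot all_order all_algebra.
From mathcomp Require Import complex.
From mathcomp Require Import all_classical all_reals all_analysis.
Set Implicit Arguments.
Unset Strict Implicit.
Unset Printing Implicit Defensive.
Import Order.TTheory GRing.Theory Num.Theory.
Import numFieldNormedType.Exports.

Local Open Scope classical_set_scope.
Local Open Scope ring_scope.
Local Open Scope complex_scope.

HB.instance Definition _ (R : realType) := NormedModule.copy R[i] (R[i])^o.

Section complex_complete.
Variable R : realType.
Implicit Types z w : R[i].

Lemma Re_normc z : (complex.Re `|z|)%:C = `|z|.
Proof. by rewrite RRe_real// normr_real. Qed.

Lemma normRe_le z : `|complex.Re z|%:C <= `|z|.
Proof. exact: normc_ge_Re. Qed.

Lemma normIm_le z : `|complex.Im z|%:C <= `|z|.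
Proof.
have := normc_ge_Re (z * 'i%C); rewrite ReiNIm normrN normrM.
suff -> : `|'i%C : R[i]| = 1 by rewrite mulr1.
by rewrite normc_def /= expr0n /= add0r expr1n sqrtr1.
Qed.

Lemma normc_leD z : `|z| <= (`|complex.Re z| + `|complex.Im z|)%:C.
Proof.
rewrite {1}(complexE z) (le_trans (ler_normD _ _))// rmorphD /= lerD//.
  by rewrite normc_def /= expr0n /= addr0 sqrtr_sqr.
rewrite normrM.
have -> : `|'i%C : R[i]| = 1.
  by rewrite normc_def /= expr0n /= add0r expr1n sqrtr1.
by rewrite mul1r normc_def /= expr0n /= addr0 sqrtr_sqr.
Qed.

Lemma ltc0_real (e : R[i]) : 0 < e -> exists2 r : R, 0 < r & e = r%:C.
Proof.
move=> e0; exists (complex.Re e); last by rewrite RRe_real// gtr0_real.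
by have := e0; rewrite ltcE => /andP[].
Qed.

Lemma complex_complete (F : set_system R[i]) :
  ProperFilter F -> cauchy F -> cvg F.
Proof.
move=> FF /cauchy_ballP Fc.
have h (p : R[i] -> R) : (forall z w, `|p z - p w|%:C <= `|z - w|) ->
    cvg (p @ F).
  move=> hp; apply: cauchy_cvg; apply/cauchy_ballP => e e0.
  have e0' : 0 < e%:C :> R[i] by rewrite ltcR.
  have [[A B] /= [FA FB] AB] := Fc _ e0'.
  exists (p @` A, p @` B) => /=.
    split; rewrite nbhs_simpl /=; [apply: filterS FA|apply: filterS FB];
      by move=> x xA; exists x.
  move=> [_ _] /= [[a Aa <-] [b Bb <-]]; rewrite /ball /=.
  have := AB (a, b) (conj Aa Bb); rewrite -ball_normE /= => abe.
  by rewrite -ltcR (le_lt_trans _ abe)// hp.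
have cRe : cvg ((@complex.Re R) @ F).
  by apply: h => z w; rewrite -raddfB normRe_le.
have cIm : cvg ((@complex.Im R) @ F).
  by apply: h => z w; rewrite -raddfB normIm_le.
apply/cvg_ex; exists (lim (@complex.Re R @ F) +i* lim (@complex.Im R @ F)).
apply/fcvgrPdist_lt => _ /ltc0_real[e e0 ->].
have e2 : 0 < e / 2 by rewrite divr_gt0.
move/cvgrPdist_lt : cRe => /(_ _ e2) cRe; move/cvgrPdist_lt : cIm => /(_ _ e2) cIm.
near=> z; rewrite (le_lt_trans (normc_leD _))// ltcR (splitr e) ltrD//.
  have -> (u v w : _) : complex.Re (u +i* v - w) = u - complex.Re w :> R.
    by case: w.
  by near: z.
have -> (u v w : _) : complex.Im (u +i* v - w) = v - complex.Im w :> R.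
  by case: w.
by near: z.
Unshelve. all: by end_near. Qed.

HB.instance Definition _ := Uniform_isComplete.Build R[i] complex_complete.

End complex_complete.

Reserved Notation "a ** b" (at level 40, left associativity).

HB.mixin Record isCStarAlgebra (R : realType) A
    & CompleteNormedModule R[i] A := {
  csmul : A -> A -> A;
  star : A -> A;
  csmulA : associative csmul;
  csmulDl : left_distributive csmul +%R;
  csmulDr : right_distributive csmul +%R;
  csmulZl : forall (k : R[i]) (a b : A), csmul (k *: a) b = k *: csmul a b;
  csmulZr : forall (k : R[i]) (a b : A), csmul a (k *: b) = k *: csmul a b;
  starK : involutive star;
  starD : {morph star : a b / a + b};
  starZ : forall (k : R[i]) (a : A), star (k *: a) = (k^*)%C *: star a;
  starM : forall a b : A, star (csmul a b) = csmul (star b) (star a);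
  normr_csmul : forall a b : A, `|csmul a b| <= `|a| * `|b|;
  normr_cstar : forall a : A, `|csmul (star a) a| = `|a| ^+ 2
}.

#[short(type="cstarAlgType")]
HB.structure Definition CStarAlgebra (R : realType) :=
  {A of CompleteNormedModule R[i] A & isCStarAlgebra R A}.

Notation "a ** b" := (csmul a b) : ring_scope.

Section star_morphisms.
Context {R : realType}.

Definition star_hom (A B : cstarAlgType R) (f : A -> B) : Prop :=
  [/\ linear f, {morph f : a b / a ** b} & {morph f : a / star a}].

Definition cstar_isomorphic (A B : cstarAlgType R) : Prop :=
  exists2 f : A -> B, star_hom f & bijective f.

Definition star_subalgebra (A : cstarAlgType R) (S : set A) : Prop :=
  [/\ S 0,
      (forall (k : R[i]) a b, S a -> S b -> S (k *: a + b)),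
      (forall a b, S a -> S b -> S (a ** b)) &
      (forall a, S a -> S (star a))].

Definition generates (A : cstarAlgType R) (G : set A) : Prop :=
  forall S : set A, closed S -> star_subalgebra S -> G `<=` S -> S = setT.

End star_morphisms.

Section c0_type.
Variables (R : realType) (X : topologicalType).

Definition vanishes_at_infinity (f : X -> R[i]) : Prop :=
  forall e : R[i], 0 < e ->
    exists2 K : set X, compact K & forall x, ~ K x -> `|f x| < e.

Definition c0_pred : {pred X -> R[i]} :=
  mem [set f : X -> R[i] | continuous f /\ vanishes_at_infinity f].

Record c0 : Type := C0 { c0_fun :> X -> R[i]; c0_funP : c0_fun \in c0_pred }.

HB.instance Definition _ := [isSub for c0_fun].
HB.instance Definition _ := [Choice of c0 by <:].

Lemma c0_continuous (f : c0) : continuous f.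
Proof. by case: f => f /= /[1!inE] -[]. Qed.

Lemma c0_vanish (f : c0) : vanishes_at_infinity f.
Proof. by case: f => f /= /[1!inE] -[]. Qed.

Lemma c0_ext (f g : c0) : (forall x, f x = g x) -> f = g.
Proof. by move=> fg; apply/val_inj/funext. Qed.

Lemma c0_submod_closed : submod_closed c0_pred.
Proof.
split.
  rewrite inE; split; first by move=> x; exact: cvg_cst.
  by move=> e e0; exists set0; [exact: compact0|move=> x _; rewrite normr0].
move=> k f g /[!inE] -[cf vf] [cg vg]; split.
  by move=> x; apply: cvgD; [apply: cvgZr; exact: cf|exact: cg].
move=> e e0; have e2 : 0 < e / 2 by rewrite divr_gt0.
have k0 : 0 < `|k| + 1 by rewrite ltr_wpDl.
have ek : 0 < e / 2 / (`|k| + 1) by rewrite divr_gt0.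
have [K cK fK] := vf _ ek; have [L cL gL] := vg _ e2.
exists (K `|` L); first exact: compactU.
move=> x /not_orP[/fK fx /gL gx].
rewrite (splitr e) (le_lt_trans (ler_normD _ _))// ler_ltD// normrM.
rewrite (@le_trans _ _ ((`|k| + 1) * `|f x|))//.
  by rewrite ler_wpM2r// lerDl.
by rewrite mulrC -ler_pdivlMr// ltW.
Qed.

HB.instance Definition _ :=
  GRing.isSubmodClosed.Build R[i] (X -> R[i]) c0_pred c0_submod_closed.
HB.instance Definition _ := [SubChoice_isSubLmodule of c0 by <:].

Definition c0_norm (f : c0) : R[i] :=
  (sup [set complex.Re `|f x| | x in [set: X]])%:C.

Lemma c0_bounded (f : c0) : has_ubound [set complex.Re `|f x| | x in [set: X]].
Proof.
have [K cK fK] := c0_vanish f (@ltr01 R[i]).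
have cRf : continuous (fun x => complex.Re `|f x|).
  move=> x; apply/cvgrPdist_lt => e e0.
  have e0' : 0 < e%:C :> R[i] by rewrite ltcR.
  have /cvgrPdist_lt/(_ _ e0') := @c0_continuous f x.
  apply: filterS => y fxy; rewrite -ltcR (le_lt_trans _ fxy)//.
  rewrite -raddfB (le_trans (normRe_le _))//.
  exact: ler_dist_dist.
have /compact_bounded [M [Mreal HM]] :
    compact ((fun x => complex.Re `|f x|) @` K).
  by apply: continuous_compact => //; exact: continuous_subspaceT.
exists (Num.max 1 (M + 1)) => _ [x _ <-].
have [Kx|nKx] := pselect (K x).
  rewrite le_max; apply/orP; right.
  apply: le_trans (ler_norm _) _; apply: (HM (M + 1)); first by rewrite ltrDl.
  by exists x.
rewrite le_max; apply/orP; left; rewrite -lecR Re_normc.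
exact/ltW/fK.
Qed.

Lemma c0_norm_ge (f : c0) x : `|f x| <= c0_norm f.
Proof.
rewrite -Re_normc lecR; apply: ub_le_sup; first exact: c0_bounded.
by exists x.
Qed.

Lemma c0_norm_le (f : c0) (r : R) : 0 <= r ->
  (forall x, `|f x| <= r%:C) -> c0_norm f <= r%:C.
Proof.
move=> r0 fr; rewrite lecR.
have [->|/set0P ne] := eqVneq [set complex.Re `|f x| | x in [set: X]] set0.
  by rewrite sup0.
by apply: ge_sup => // _ [x _ <-]; rewrite -lecR Re_normc.
Qed.

Lemma c0_norm_ge0 (f : c0) : 0 <= c0_norm f.
Proof.
have [x|nx] := pselect (exists x : X, True); last first.
  rewrite /c0_norm ler0c (_ : [set _ | _ in _] = set0) ?sup0//.
  by apply/eqP/negPn/negP => /set0P[_ [x _ _]]; apply: nx; exists x.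
by case: x => x _; rewrite (le_trans _ (c0_norm_ge f x)).
Qed.

Lemma c0_normE (f : c0) : exists2 r : R, 0 <= r & c0_norm f = r%:C.
Proof. by eexists; last reflexivity; have := c0_norm_ge0 f; rewrite ler0c. Qed.

Lemma c0_ler_normD f g : c0_norm (f + g) <= c0_norm f + c0_norm g.
Proof.
have [r r0 Er] := c0_normE f; have [s s0 Es] := c0_normE g.
rewrite Er Es -rmorphD; apply: c0_norm_le; first exact: addr_ge0.
move=> x; rewrite rmorphD /= -Er -Es (le_trans (ler_normD _ _))//.
by rewrite lerD// c0_norm_ge.
Qed.

Lemma c0_normrZ (k : R[i]) f : c0_norm (k *: f) = `|k| * c0_norm f.
Proof.
have Z (c : R[i]) g : c0_norm (c *: g) <= `|c| * c0_norm g.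
  have [r r0 Er] := c0_normE g.
  rewrite Er -(Re_normc c) -rmorphM /=; apply: c0_norm_le.
    by rewrite mulr_ge0// -ler0c Re_normc.
  move=> x; rewrite rmorphM /= Re_normc -Er normrM ler_wpM2l//.
  exact: c0_norm_ge.
apply/eqP; rewrite eq_le Z /=.
have [->|k0] := eqVneq k 0; first by rewrite normr0 mul0r c0_norm_ge0.
rewrite mulrC -ler_pdivlMr ?normr_gt0// -normfV mulrC.
rewrite (le_trans _ (Z k^-1 (k *: f)))//.
by rewrite scalerA mulVf// scale1r.
Qed.

Lemma c0_norm0_eq0 f : c0_norm f = 0 -> f = 0.
Proof.
move=> f0; apply: c0_ext => x; apply/normr0_eq0/eqP; rewrite eq_le normr_ge0.
by rewrite -f0 c0_norm_ge.
Qed.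

HB.instance Definition _ := Lmodule_isNormed.Build R[i] c0
  c0_ler_normD c0_normrZ c0_norm0_eq0.

Lemma c0_normrE (f : c0) : `|f| = c0_norm f. Proof. by []. Qed.

Lemma c0_complete (F : set_system c0) : ProperFilter F -> cauchy F -> cvg F.
Proof.
move=> FF /cauchy_ballP Fc.
have ev x : cvg ((fun f : c0 => f x) @ F).
  apply: cauchy_cvg; apply/cauchy_ballP => e e0.
  have [[A B] /= [FA FB] AB] := Fc _ e0.
  exists ((fun f : c0 => f x) @` A, (fun f : c0 => f x) @` B) => /=.
    split; rewrite nbhs_simpl /=; [apply: filterS FA|apply: filterS FB];
      by move=> f fA; exists f.
  move=> [_ _] /= [[a Aa <-] [b Bb <-]]; rewrite -ball_normE /=.
  have := AB (a, b) (conj Aa Bb); rewrite -ball_normE /=; apply: le_lt_trans.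
  exact: (c0_norm_ge (a - b) x).
pose g x := lim ((fun f : c0 => f x) @ F).
have unif (e : R[i]) : 0 < e ->
      \forall f \near F, forall x, `|g x - (f : c0) x| <= e.
  move=> e0; have e2 : 0 < e / 2 by rewrite divr_gt0.
  have [[A B] /= [FA FB] AB] := Fc _ e2.
  near=> f; move=> x.
  have /cvgrPdist_lt/(_ _ e2) gx := ev x.
  have /filter_ex[h [hA hx]] : F (A `&` [set h : c0 | `|g x - h x| < e / 2]).
    exact: filterI.
  rewrite (splitr e) -(subrKA (h x)) (le_trans (ler_normD _ _))// lerD//.
    exact: ltW.
  have Bf : B f by near: f.
  have := AB (h, f) (conj hA Bf); rewrite -ball_normE /= => /ltW; apply: le_trans.
  exact: (c0_norm_ge (h - f) x).
have gc : continuous g.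
  move=> x; apply/cvgrPdist_lt => e e0.
  have e3 : 0 < e / 3 by rewrite divr_gt0.
  have /filter_ex[f fg] := unif _ e3.
  have /cvgrPdist_lt/(_ _ e3) := @c0_continuous f x.
  apply: filterS => y fxy.
  have -> : g x - g y = (g x - f x) + (f x - f y) + - (g y - f y).
    by rewrite opprB !subrKA.
  have -> : e = e / 3 + e / 3 + e / 3.
    by rewrite -!mulrDl -mulr2n -mulrSr -[e *+ 3]mulr_natr mulfK ?pnatr_eq0.
  rewrite (le_lt_trans (ler_normD _ _))// normrN ltr_leD//.
  by rewrite (le_lt_trans (ler_normD _ _))// ler_ltD.
have gv : vanishes_at_infinity g.
  move=> e e0; have e2 : 0 < e / 2 by rewrite divr_gt0.
  have /filter_ex[f fg] := unif _ e2.
  have [K cK fK] := c0_vanish f e2; exists K => // x /fK fx.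
  rewrite -(subrK (f x) (g x)) (splitr e) (le_lt_trans (ler_normD _ _))//.
  by rewrite ler_ltD.
have gP : g \in c0_pred by rewrite inE.
apply/cvg_ex; exists (C0 gP); apply/fcvgrPdist_lt => _ /ltc0_real[e e0 ->].
have e2 : 0 < (e / 2)%:C :> R[i] by rewrite ltcR divr_gt0.
apply: filterS (unif _ e2) => f fg.
apply: (@le_lt_trans _ _ (e / 2)%:C); last by rewrite ltcR ltr_pdivrMr// ltr_pMr// ltr1n.
by apply: c0_norm_le => //; rewrite ltW// divr_gt0.
Unshelve. all: by end_near. Qed.

HB.instance Definition _ := Uniform_isComplete.Build c0 c0_complete.

Lemma c0_mulP (f g : c0) : (fun x => f x * g x) \in c0_pred.
Proof.
rewrite inE; split.
  by move=> x; apply: cvgM; exact: c0_continuous.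
move=> e e0; have g0 : 0 < c0_norm g + 1 by rewrite ltr_wpDl// c0_norm_ge0.
have ek : 0 < e / (c0_norm g + 1) by rewrite divr_gt0.
have [K cK fK] := c0_vanish f ek; exists K => // x /fK fx.
rewrite normrM (le_lt_trans (y := `|f x| * (c0_norm g + 1)))//.
  by rewrite ler_wpM2l// (le_trans (c0_norm_ge g x))// lerDl.
by rewrite -ltr_pdivlMr.
Qed.

Lemma c0_conjP (f : c0) : (fun x => (f x)^*) \in c0_pred.
Proof.
rewrite inE; split.
  move=> x; apply/cvgrPdist_lt => e e0.
  have /cvgrPdist_lt/(_ _ e0) := @c0_continuous f x.
  by apply: filterS => y; rewrite -rmorphB /= normcJ.
move=> e e0; have [K cK fK] := c0_vanish f e0.
by exists K => // x /fK; rewrite normcJ.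
Qed.

Definition c0_mul (f g : c0) : c0 := C0 (c0_mulP f g).
Definition c0_star (f : c0) : c0 := C0 (c0_conjP f).

Lemma c0_mulA : associative c0_mul.
Proof. by move=> f g h; apply: c0_ext => x /=; rewrite mulrA. Qed.

Lemma c0_mulDl : left_distributive c0_mul +%R.
Proof. by move=> f g h; apply: c0_ext => x /=; rewrite mulrDl. Qed.

Lemma c0_mulDr : right_distributive c0_mul +%R.
Proof. by move=> f g h; apply: c0_ext => x /=; rewrite mulrDr. Qed.

Lemma c0_mulZl (k : R[i]) f g : c0_mul (k *: f) g = k *: c0_mul f g.
Proof. by apply: c0_ext => x /=; rewrite -scalerAl. Qed.

Lemma c0_mulZr (k : R[i]) f g : c0_mul f (k *: g) = k *: c0_mul f g.
Proof. by apply: c0_ext => x; exact: mulrCA. Qed.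

Lemma c0_starK : involutive c0_star.
Proof. by move=> f; apply: c0_ext => x /=; rewrite conjcK. Qed.

Lemma c0_starD : {morph c0_star : f g / f + g}.
Proof. by move=> f g; apply: c0_ext => x /=; rewrite rmorphD. Qed.

Lemma c0_starZ (k : R[i]) f : c0_star (k *: f) = (k^*)%C *: c0_star f.
Proof. by apply: c0_ext => x /=; rewrite rmorphM. Qed.

Lemma c0_starM f g : c0_star (c0_mul f g) = c0_mul (c0_star g) (c0_star f).
Proof. by apply: c0_ext => x /=; rewrite rmorphM mulrC. Qed.

Lemma c0_norm_mul f g : `|c0_mul f g| <= `|f| * `|g|.
Proof.
rewrite !c0_normrE.
have [r r0 Er] := c0_normE f; have [s s0 Es] := c0_normE g.
rewrite Er Es -rmorphM; apply: c0_norm_le; first exact: mulr_ge0.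
by move=> x; rewrite rmorphM /= -Er -Es normrM ler_pM// c0_norm_ge.
Qed.

Lemma c0_norm_cstar f : `|c0_mul (c0_star f) f| = `|f| ^+ 2.
Proof.
rewrite !c0_normrE; set n := c0_norm (c0_mul _ _).
have [r r0 Er] := c0_normE (c0_mul (c0_star f) f).
have [s s0 Es] := c0_normE f.
apply/eqP; rewrite eq_le; apply/andP; split.
  rewrite Es -rmorphXn; apply: c0_norm_le; first by rewrite exprn_ge0.
  move=> x; rewrite rmorphXn /= -Es normrM normcJ -expr2.
  by rewrite ler_pXn2r ?nnegrE// ?c0_norm_ge0// c0_norm_ge.
have fx x : `|f x| ^+ 2 <= r%:C.
  rewrite -Er (le_trans _ (c0_norm_ge _ x))//=.
  by rewrite normrM normcJ expr2.
have sr : s <= Num.sqrt r.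
  rewrite -lecR -Es; apply: c0_norm_le; first exact: sqrtr_ge0.
  move=> x; rewrite -Re_normc lecR -(@ler_pXn2r _ 2) ?nnegrE ?sqrtr_ge0//.
    by rewrite sqr_sqrtr// -lecR rmorphXn /= Re_normc.
  by rewrite -ler0c Re_normc.
rewrite /n Er Es -rmorphXn lecR -(sqr_sqrtr r0).
by rewrite ler_pXn2r ?nnegrE ?sqrtr_ge0.
Qed.

HB.instance Definition _ := isCStarAlgebra.Build R c0
  c0_mulA c0_mulDl c0_mulDr c0_mulZl c0_mulZr c0_starK c0_starD c0_starZ
  c0_starM c0_norm_mul c0_norm_cstar.

End c0_type.

(* Inner products are conjugate linear in the first variable; an element of
   a C*-algebra is positive when it is of the form b^* b. *)
HB.mixin Record isHilbertModule (R : realType) (A : cstarAlgType R) E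
    & CompleteNormedModule R[i] E := {
  ract : E -> A -> E;
  hinner : E -> E -> A;
  ractDl : forall (x y : E) (a : A), ract (x + y) a = ract x a + ract y a;
  ractDr : forall (x : E) (a b : A), ract x (a + b) = ract x a + ract x b;
  ractZl : forall (k : R[i]) (x : E) (a : A), ract (k *: x) a = k *: ract x a;
  ractZr : forall (k : R[i]) (x : E) (a : A), ract x (k *: a) = k *: ract x a;
  ractM : forall (x : E) (a b : A), ract x (a ** b) = ract (ract x a) b;
  hinnerDr : forall x y z : E, hinner x (y + z) = hinner x y + hinner x z;
  hinnerZr : forall (k : R[i]) (x y : E), hinner x (k *: y) = k *: hinner x y;
  hinner_ractr : forall (x y : E) (a : A),
    hinner x (ract y a) = hinner x y ** a;
  star_hinner : forall x y : E, star (hinner x y) = hinner y x;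
  hinner_ge0 : forall x : E, exists b : A, hinner x x = star b ** b;
  normr_hinner : forall x : E, `|x| ^+ 2 = `|hinner x x|
}.

#[short(type="hilbertModType")]
HB.structure Definition HilbertModule (R : realType) (A : cstarAlgType R) :=
  {E of CompleteNormedModule R[i] E & isHilbertModule R A E}.

Section operators.
Context {R : realType} {A : cstarAlgType R} {E : hilbertModType A}.
Implicit Types S : E -> E.

Definition is_adjoint S S' : Prop :=
  forall x y : E, hinner (S x) y = hinner x (S' y).

Definition adjointable S : Prop := exists S', is_adjoint S S'.

Definition theta (x y : E) : E -> E := fun z => ract x (hinner y z).

Definition finite_rank S : Prop :=
  exists n (c : 'I_n -> R[i]) (x y : 'I_n -> E),
    forall z, S z = \sum_(i < n) c i *: theta (x i) (y i) z.

(* The closure is taken for the operator norm. *)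
Definition compact_op S : Prop :=
  adjointable S /\
  forall e : R[i], 0 < e ->
    exists2 F : E -> E, finite_rank F & forall z, `|S z - F z| <= e * `|z|.

End operators.

(* Through lact_adjoint, each lact a is an adjointable operator with adjoint
   lact (star a), so that lact is a *-homomorphism from A to L(E). *)
HB.mixin Record isCorrespondence (R : realType) (A : cstarAlgType R) E
    & HilbertModule R A E := {
  lact : A -> E -> E;
  lact_linear : forall (k : R[i]) (a b : A) (x : E),
    lact (k *: a + b) x = k *: lact a x + lact b x;
  lactM : forall (a b : A) (x : E), lact (a ** b) x = lact a (lact b x);
  lact_adjoint : forall a : A, is_adjoint (lact a) (lact (star a))
}.

#[short(type="corrType")]
HB.structure Definition Correspondence (R : realType) (A : cstarAlgType R) :=
  {E of HilbertModule R A E & isCorrespondence R A E}.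

Section representations.
Context {R : realType} {A : cstarAlgType R} (E : corrType A).

Definition representation (B : cstarAlgType R) (T : E -> B) (pi : A -> B) :
    Prop :=
  [/\ linear T, star_hom pi,
      (forall x y, star (T x) ** T y = pi (hinner x y)) &
      (forall a x, T (lact a x) = pi a ** T x)].

(* Psi represents Psi_T: a *-homomorphism on K(E), determined by its values
   on the operators theta x y; its values outside K(E) are irrelevant. *)
Definition induced_hom (B : cstarAlgType R) (T : E -> B)
    (Psi : (E -> E) -> B) : Prop :=
  [/\ (forall x y, Psi (theta x y) = T x ** star (T y)),
      (forall (k : R[i]) S S', compact_op S -> compact_op S' ->
         Psi (fun z => k *: S z + S' z) = k *: Psi S + Psi S'),
      (forall S S', compact_op S -> compact_op S' ->
         Psi (S \o S') = Psi S ** Psi S') &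
      (forall S S', compact_op S -> is_adjoint S S' ->
         Psi S' = star (Psi S))].

Definition coisometric (K : set A) (B : cstarAlgType R) (T : E -> B)
    (pi : A -> B) : Prop :=
  exists2 Psi, induced_hom T Psi & forall a, K a -> Psi (lact a) = pi a.

Definition corr_J : set A := [set a | compact_op (lact a : E -> E)].

Definition corr_ker : set A := [set a | forall x : E, lact a x = 0].

Definition annihilator (I : set A) : set A :=
  [set a | forall b, I b -> a ** b = 0].

Definition katsura_ideal : set A := corr_J `&` annihilator corr_ker.

(* O(K, E) through its universal property, which determines it up to
   isomorphism: the C*-algebra generated by a universal representation among
   those that are coisometric on K. *)
Record relative_cuntz_pimsner (K : set A) := RelativeCuntzPimsner {
  cp_alg :> cstarAlgType R;
  cp_T : E -> cp_alg;
  cp_pi : A -> cp_alg;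
  cp_representation : representation cp_T cp_pi;
  cp_coisometric : coisometric K cp_T cp_pi;
  cp_generates : generates (range cp_T `|` range cp_pi);
  cp_universal : forall (B : cstarAlgType R) (T : E -> B) (pi : A -> B),
    representation T pi -> coisometric K T pi ->
    exists rho : cp_alg -> B,
      [/\ star_hom rho, (forall x, rho (cp_T x) = T x) &
          (forall a, rho (cp_pi a) = pi a)]
}.

Definition toeplitz_pimsner := relative_cuntz_pimsner [set 0].
Definition cuntz_pimsner := relative_cuntz_pimsner katsura_ideal.

End representations.

(* Measurable types of the library are pointed, whereas the space of edges of
   a quiver may be empty. Borel measures are therefore set functions on an
   arbitrary space T, and the measurable type that underlies integration is
   formed from T and a base point. Neither its measurable sets nor the
   integrals depend on the base point. *)

Definition pointed_at (T : topologicalType) (t0 : T) : Type := T.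

HB.instance Definition _ (T : topologicalType) (t0 : T) :=
  Choice.on (pointed_at t0).
HB.instance Definition _ (T : topologicalType) (t0 : T) :=
  isPointed.Build (pointed_at t0) t0.

Definition borel (T : topologicalType) : set (set T) := <<s @open T >>.

Notation borel_at t0 :=
  (g_sigma_algebraType (@open _ : set (set (pointed_at t0)))).

Record radon_measure (R : realType) (T : topologicalType) := RadonMeasure {
  radon_fun :> set T -> \bar R;
  radon0 : radon_fun set0 = 0%E;
  radon_ge0 : forall B, (0 <= radon_fun B)%E;
  radon_sigma_additive : forall F : (set T)^nat,
    (forall n, borel (F n)) -> trivIset setT F ->
    (fun n => \sum_(0 <= i < n) radon_fun (F i))%E @ \oo -->
      radon_fun (\bigcup_n F n);
  radon_compact : forall K, compact K -> (radon_fun K < +oo)%E;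
  radon_outer : forall B, borel B ->
    radon_fun B =
      ereal_inf [set radon_fun U | U in [set U | open U /\ B `<=` U]];
  radon_inner : forall U, open U ->
    radon_fun U =
      ereal_sup [set radon_fun K | K in [set K | compact K /\ K `<=` U]]
}.

Section integration.
Context {R : realType} {T : topologicalType}.

Lemma radon_semi_sigma_additive (mu : radon_measure R T) (t0 : T) :
  semi_sigma_additive (radon_fun mu : set (borel_at t0) -> \bar R).
Proof. by move=> F mF tF _; exact: radon_sigma_additive. Qed.

HB.instance Definition _ (mu : radon_measure R T) (t0 : T) :=
  isMeasure.Build _ (borel_at t0) R (radon_fun mu : set (borel_at t0) -> \bar R)
    (radon0 mu) (radon_ge0 mu) (@radon_semi_sigma_additive mu t0).

Definition borel_integral (mu : set T -> \bar R) (D : set T)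
    (f : T -> \bar R) : \bar R :=
  match pselect (exists t0 : T, True) with
  | left ht => let t0 := projT1 (cid ht) in
      (\int[mu : set (borel_at t0) -> \bar R]_(x in D) f x)%E
  | right _ => 0%E
  end.

Definition complex_integral (mu : set T -> \bar R) (D : set T)
    (f : T -> R[i]) : R[i] :=
  fine (borel_integral mu D (fun x => (complex.Re (f x))%:E)) +i*
  fine (borel_integral mu D (fun x => (complex.Im (f x))%:E)).

Definition measure_support (mu : set T -> \bar R) : set T :=
  [set t | forall U, open_nbhs t U -> (0 < mu U)%E].

Definition Cc : set (T -> R[i]) :=
  [set f | continuous f /\ compact (closure [set t | f t != 0])].

End integration.

Record topological_quiver (R : realType) := TopologicalQuiver {
  vertex : topologicalType;
  edge : topologicalType;
  rng : edge -> vertex;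
  src : edge -> vertex;
  lam : vertex -> radon_measure R edge;
  vertex_second_countable : @second_countable vertex;
  vertex_locally_compact : locally_compact [set: vertex];
  vertex_hausdorff : hausdorff_space vertex;
  edge_second_countable : @second_countable edge;
  edge_locally_compact : locally_compact [set: edge];
  edge_hausdorff : hausdorff_space edge;
  rng_continuous : continuous rng;
  src_continuous : continuous src;
  rng_open : forall U, open U -> open (rng @` U);
  lam_support : forall y, measure_support (lam y) = rng @^-1` [set y];
  lam_Cc : forall f : edge -> R[i], Cc f ->
    Cc (fun y => complex_integral (lam y) setT f)
}.

Arguments rng {R t} _.
Arguments src {R t} _.
Arguments lam {R t} _.

(* E_Q: a C*-correspondence over C_0(X) into which C_c(E) maps with dense
   range, compatibly with the inner product and the actions of C_0(X). Since
   the norm of the correspondence is given by its inner product, this is the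
   completion of C_c(E). Values of quiver_incl outside C_c(E) are
   irrelevant. *)
Record quiver_correspondence (R : realType) (Q : topological_quiver R) :=
    QuiverCorrespondence {
  quiver_corr :> corrType (c0 R (vertex Q));
  quiver_incl : (edge Q -> R[i]) -> quiver_corr;
  quiver_incl_linear : forall (k : R[i]) f g, Cc f -> Cc g ->
    quiver_incl (k *: f + g) = k *: quiver_incl f + quiver_incl g;
  quiver_incl_inner : forall f g, Cc f -> Cc g -> forall y,
    hinner (quiver_incl f) (quiver_incl g) y =
      complex_integral (lam y) (rng @^-1` [set y]) (fun e => ((f e)^*)%C * g e);
  quiver_incl_lact : forall (a : c0 R (vertex Q)) f, Cc f ->
    lact a (quiver_incl f) = quiver_incl (fun e => a (src e) * f e);
  quiver_incl_ract : forall (b : c0 R (vertex Q)) f, Cc f ->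
    ract (quiver_incl f) b = quiver_incl (fun e => f e * b (rng e));
  quiver_incl_dense : closure (quiver_incl @` Cc) = setT
}.

Definition homeomorphism (S T : topologicalType) (f : S -> T) : Prop :=
  exists g : T -> S,
    [/\ cancel f g, cancel g f, continuous f & continuous g].

Definition measurable_homeomorphism (S T : topologicalType) (f : S -> T) :
    Prop :=
  [/\ homeomorphism f, (forall B, borel B -> borel (f @^-1` B)) &
      (forall B, borel B -> borel (f @` B))].

Definition quiver_isomorphic (R : realType) (Q Q' : topological_quiver R) :
    Prop :=
  exists (phi : vertex Q -> vertex Q') (psi : edge Q -> edge Q')
      (h : vertex Q -> R),
    [/\ homeomorphism phi, measurable_homeomorphism psi,
        (forall y, 0 < h y),
        (forall e, phi (src e) = src (psi e) /\ phi (rng e) = rng (psi e)) &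
        (forall y B, borel B ->
          lam (phi y) B =
            borel_integral (fun C => lam y (psi @^-1` C)) B
              (fun=> (h y)%:E))].

(* Main.v *)
(* An isomorphism of quivers forces the density [h] to be continuous on the range
   of [r], where it is a quotient of integrals of a bump function.  Hence
   [f |-> (f o psi^-1) * (h o r o psi^-1)^(-1/2)] maps [C_c(E)] onto [C_c(E')],
   preserves the inner products up to [a |-> a o phi^-1], and extends to an
   isomorphism of C*-correspondences.  Such an isomorphism transports compact
   operators, the Katsura ideal and coisometric representations, so the universal
   properties yield *-homomorphisms in both directions.  These are mutually
   inverse on generators, hence everywhere, because *-homomorphisms between
   C*-algebras are contractive. *)

Require Import Defs.
From HB Require Import structures.
From mathcomp Require Import all_boot all_order all_algebra.
From mathcomp Require Import complex lra.
From mathcomp Require Import all_classical all_reals all_analysis measurable_realfun.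
Set Implicit Arguments.
Unset Strict Implicit.
Unset Printing Implicit Defensive.
Import Order.TTheory GRing.Theory Num.Theory.
Import numFieldNormedType.Exports.

Local Open Scope classical_set_scope.
Local Open Scope ring_scope.
Local Open Scope complex_scope.

(** * Contractivity of *-homomorphisms *)

Section complex_norms.
Context {R : realType}.
Implicit Types V W : normedModType R[i].

(** The algebras carry no unit and no functional calculus, so contractivity of *-homomorphisms has
    to come from polynomial relations, which are all that a *-homomorphism preserves. For
    self-adjoint [a] of norm below 1, a fixed point argument gives [y] with (1 - y)^2 = 1 - a^2;
    then f(a) + i(1 - f(y)) and f(a) - i(1 - f(y)) act as unitaries with sum 2 f(a). Contractivity
    also makes *-isomorphisms isometric, so that a map preserving inner products up to one of them
    preserves distances and extends by completeness.

    The density [h] is a bare family of numbers. At a vertex outside the range of [r] the measure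
    vanishes and every value of [h] is admissible, so continuity can be claimed only for h o r. The
    exponent -1/2 is forced by sesquilinearity: the factor enters an inner product twice and has to
    cancel one factor h. *)

Lemma realcM (x y : R) : (x * y)%:C = x%:C * y%:C.
Proof. exact: rmorphM. Qed.

Lemma realcD (x y : R) : (x + y)%:C = x%:C + y%:C.
Proof. exact: rmorphD. Qed.

Lemma normc_realE V (x : V) : exists2 r : R, 0 <= r & `|x| = r%:C.
Proof.
exists (complex.Re `|x|); last by rewrite RRe_real// normr_real.
by rewrite -ler0c RRe_real// normr_real.
Qed.

Lemma lec_addgt0P V (x : V) (c : R) :
  (forall e : R, 0 < e -> `|x| <= (c + e)%:C) -> `|x| <= c%:C.
Proof.
have [r _ ->] := normc_realE x => h; rewrite lecR; apply/ler_addgt0Pr => e e0.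
by rewrite -lecR h.
Qed.

Lemma norm_le_gt0_eq0 V (x : V) :
  (forall e : R, 0 < e -> `|x| <= e%:C) -> x = 0.
Proof.
move=> h; apply/normr0_eq0/eqP; rewrite eq_le normr_ge0 andbT.
by apply: lec_addgt0P => e /h; rewrite add0r.
Qed.

Lemma cvg_geometric_steps (V : completeNormedModType R[i]) (u : nat -> V)
    (r : R) : 0 <= r < 1 -> (forall n, `|u n.+1 - u n| <= (r ^+ n)%:C) ->
  cvgn u.
Proof.
move=> /andP[r0 r1] hu; have r1' : 0 < 1 - r by rewrite subr_gt0.
have hm n m : `|u (n + m)%N - u n| <= (r ^+ n / (1 - r))%:C.
  (* The exact partial sum of the geometric series is what the induction on [m] can carry; the bound
     by the full series is not inductive. *)
  suff h : `|u (n + m)%N - u n| <= (r ^+ n * ((1 - r ^+ m) / (1 - r)))%:C.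
    apply: le_trans h _; rewrite lecR ler_wpM2l ?exprn_ge0//.
    by rewrite -[leRHS]mul1r ler_wpM2r ?invr_ge0 ?(ltW r1')// gerBl exprn_ge0.
  elim: m => [|m IH]; first by rewrite addn0 subrr normr0 expr0 subrr mul0r mulr0.
  rewrite addnS -(subrKA (u (n + m)%N)) (le_trans (ler_normD _ _))//.
  rewrite (le_trans (lerD (hu _) IH))// -realcD /= lecR.
  rewrite exprD -mulrDr ler_wpM2l ?exprn_ge0//.
  rewrite -[X in X + _](mulfK (lt0r_neq0 r1')) -mulrDl ler_wpM2r ?invr_ge0 ?(ltW r1')//.
  by rewrite mulrBr mulr1 -exprSr addrC addrA subrK.
apply: cauchy_cvg; apply/cauchy_ballP => _ /ltc0_real[e e0 ->].
have e2 : 0 < e * (1 - r) / 2 by rewrite divr_gt0// mulr_gt0.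
have rn : (fun n => r ^+ n) @ \oo --> (0 : R) by apply: cvg_expr; rewrite ger0_norm.
have /cvgrPdist_lt/(_ _ e2) [N _ hN] := rn.
have hNe : r ^+ N / (1 - r) < e / 2.
  rewrite ltr_pdivrMr// mulrAC; have := hN N (leqnn N) => /=.
  by rewrite sub0r normrN ger0_norm ?exprn_ge0.
have uN n : (N <= n)%N -> `|u n - u N| < (e / 2)%:C.
  move=> Nn; rewrite -(subnKC Nn) (le_lt_trans (hm _ _))// ltcR.
  exact: hNe.
exists (u @` [set n | (N <= n)%N], u @` [set n | (N <= n)%N]) => /=.
  by split; rewrite nbhs_simpl /=; exists N => // n /= Nn; exists n.
move=> [_ _] /= [[n Nn <-] [m Nm <-]]; rewrite -ball_normE /=.
rewrite -(subrKA (u N)) (le_lt_trans (ler_normD _ _))//.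
rewrite (splitr e) realcD ltrD//=; first exact: uN.
by rewrite distrC; exact: uN.
Qed.

End complex_norms.

Section cstar_arithmetic.
Context {R : realType} {A : cstarAlgType R}.
Implicit Types a b c : A.

Lemma csmulNl a b : (- a) ** b = - (a ** b).
Proof. by rewrite -scaleN1r csmulZl scaleN1r. Qed.

Lemma csmulNr a b : a ** (- b) = - (a ** b).
Proof. by rewrite -(scaleN1r b) csmulZr scaleN1r. Qed.

Lemma csmulBl a b c : (a - b) ** c = a ** c - b ** c.
Proof. by rewrite csmulDl csmulNl. Qed.

Lemma csmulBr a b c : a ** (b - c) = a ** b - a ** c.
Proof. by rewrite csmulDr csmulNr. Qed.

Lemma star0 : star (0 : A) = 0.
Proof. by rewrite -(scale0r 0) starZ rmorph0 !scale0r. Qed.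

Lemma starN a : star (- a) = - star a.
Proof. by rewrite -scaleN1r starZ rmorphN rmorph1 scaleN1r. Qed.

Lemma starB a b : star (a - b) = star a - star b.
Proof. by rewrite starD starN. Qed.

Lemma norm_star a : `|star a| = `|a|.
Proof.
have le b : `|b| <= `|star b|.
  have [->|b0] := eqVneq b 0; first by rewrite star0.
  have nb : 0 < `|b| by rewrite normr_gt0.
  by rewrite -(ler_pM2r nb) -expr2 -normr_cstar normr_csmul.
by apply/eqP; rewrite eq_le le andbT -{2}(starK a) le.
Qed.

(* The equation says [(1 - y) ^ 2 = 1 - x]. *)
Lemma half_square_fixpoint (x : A) (r : R) : 0 <= r < 1 -> `|x| <= r%:C ->
  exists2 y, `|y| <= r%:C & 2%:R *: y = x + y ** y.
Proof.
move=> /[dup] r01 /andP[r0 r1] xr.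
(* Picard iteration for [F], started at 0. On the ball of radius [r], the identity z^2 - w^2 = z(z -
   w) + (z - w)w, valid without commutativity, makes [F] a contraction of ratio [r]. *)
pose F z := 2%:R^-1 *: (x + z ** z).
have n2 : `|2%:R^-1 : R[i]| = (2%:R^-1)%:C.
  by rewrite ger0_norm ?invr_ge0 ?ler0n// fmorphV rmorphMn.
have Fball z : `|z| <= r%:C -> `|F z| <= r%:C.
  move=> zr; rewrite normrZ n2.
  rewrite (@le_trans _ _ ((2%:R^-1)%:C * (r + r)%:C))//; last first.
    by rewrite -realcM lecR; lra.
  rewrite ler_wpM2l ?ler0c ?invr_ge0// realcD (le_trans (ler_normD _ _))//.
  rewrite lerD// (le_trans (normr_csmul _ _))//.
  rewrite (le_trans (ler_pM _ _ zr zr))// -realcM lecR.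
  by rewrite ler_piMl// ltW.
have Flip z w : `|z| <= r%:C -> `|w| <= r%:C -> `|F z - F w| <= r%:C * `|z - w|.
  move=> zr wr; rewrite -scalerBr normrZ n2.
  have -> : x + z ** z - (x + w ** w) = z ** (z - w) + (z - w) ** w.
    by rewrite csmulBr csmulBl subrKA opprD addrACA subrr add0r.
  have [d d0 Ed] := normc_realE (z - w).
  rewrite (@le_trans _ _ ((2%:R^-1)%:C * (r * d + d * r)%:C))//; last first.
    rewrite Ed -!realcM lecR; lra.
  rewrite ler_wpM2l ?ler0c ?invr_ge0// realcD (le_trans (ler_normD _ _))//.
  by rewrite !realcM /= -Ed lerD// (le_trans (normr_csmul _ _))// ler_pM.
pose u n := iter n F 0.
have ur n : `|u n| <= r%:C.
  by elim: n => [|n IH] /=; [rewrite normr0 ler0c|exact: Fball].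
have ustep n : `|u n.+1 - u n| <= (r ^+ n)%:C.
  elim: n => [|n IH].
    by rewrite subr0 (le_trans (ur _))// expr0 lecR ltW.
  apply: le_trans (Flip (u n.+1) (u n) (ur _) (ur _)) _.
  by rewrite exprS realcM ler_wpM2l ?ler0c.
have uc := cvg_geometric_steps r01 ustep.
set p := limn u in uc.
have up (e : R) : 0 < e -> exists n, `|p - u n| <= e%:C /\ `|p - u n.+1| <= e%:C.
  move=> e0; have e0' : 0 < e%:C by rewrite ltcR.
  have /cvgrPdist_le/(_ _ e0') [N _ hN] := uc.
  by exists N; split; apply: hN => //=.
have pr : `|p| <= r%:C.
  apply: lec_addgt0P => e /up[n [pn _]].
  rewrite -(subrK (u n) p) (le_trans (ler_normD _ _))//.
  by rewrite addrC realcD lerD.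
exists p => //.
suff {1}-> : p = F p by rewrite scalerA divff ?pnatr_eq0// scale1r.
apply/eqP; rewrite -subr_eq0; apply/eqP/norm_le_gt0_eq0 => e e0.
have [n [pn pn1]] := up _ (divr_gt0 e0 (@ltr0Sn R 1)).
rewrite -(subrKA (u n.+1)) (le_trans (ler_normD _ _))//.
rewrite (splitr e) realcD lerD//=.
apply: le_trans (Flip (u n) p (ur _) pr) _.
rewrite distrC (le_trans (ler_wpM2l _ pn)) ?ler0c// -realcM lecR.
by rewrite ler_piMl ?divr_ge0 ?(ltW e0)// ltW.
Qed.

End cstar_arithmetic.

Section star_hom_contractive.
Context {R : realType}.

(** Taking norms gives 2|d| <= 2r|d|. This is the uniqueness side of the fixed point: with d = y -
    y* and d = ay - ya it shows that the solution [y] is self-adjoint and commutes with [a]. *)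
Lemma contracted_eq0 (A : cstarAlgType R) (d v w : A) (r : R) : r < 1 ->
  `|v| <= r%:C -> `|w| <= r%:C -> 2%:R *: d = d ** v + w ** d -> d = 0.
Proof.
move=> r1 vr wr h; have [s s0 Es] := normc_realE d.
have : `|2%:R *: d| <= `|d| * r%:C + r%:C * `|d|.
  rewrite h (le_trans (ler_normD _ _))// lerD// (le_trans (normr_csmul _ _))//.
    by rewrite ler_wpM2l.
  by rewrite ler_wpM2r.
rewrite normrZ normr_nat Es -(rmorphMn (real_complex R) 2 1) -!rmorphM -rmorphD lecR.
rewrite [s * r]mulrC -mulr2n -[leRHS]mulr_natl ler_pM2l ?ltr0n// => sr.
apply/normr0_eq0; rewrite Es; congr (_ %:C); apply/eqP; move: sr.
rewrite -{1}[s]mul1r -subr_le0 -mulrBl pmulr_rle0 ?subr_gt0// => sr.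
by rewrite eq_le sr s0.
Qed.

(* With [k = 'i] or [- 'i], the operator [p + k (1 - q)] is a unitary. *)
Lemma norm_unitary_mul (A : cstarAlgType R) (p q b : A) (k : R[i]) :
  star p = p -> star q = q -> p ** q = q ** p -> 2%:R *: q = p ** p + q ** q ->
  (k^*)%C = - k -> k * k = -1 ->
  `|p ** b + k *: (b - q ** b)| = `|b|.
Proof.
move=> ps qs pq h kc kk.
(* Without a unit, 1 - q exists only through its action on [b]. The hypothesis 2q = p^2 + q^2 says
   p^2 + (1 - q)^2 = 1, and the cross terms cancel because [p] and [q] commute and [k] is
   imaginary. *)
suff e : star (p ** b + k *: (b - q ** b)) ** (p ** b + k *: (b - q ** b)) =
    star b ** b.
  apply/eqP; rewrite -(@eqrXn2 _ 2)//.
  by rewrite -!normr_cstar e.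
rewrite starD starZ kc starB !starM ps qs.
set b' := star b.
rewrite csmulDl !csmulDr !csmulZl !csmulZr scalerA mulNr kk opprK scale1r.
have -> : b' ** p ** (b - q ** b) = (b' - b' ** q) ** (p ** b).
  by rewrite csmulBr csmulBl -!csmulA (csmulA p q) pq -(csmulA q p).
rewrite scaleNr addrA addrK addrC.
have -> : b' ** p ** (p ** b) = b' ** (2%:R *: q - q ** q) ** b.
  by rewrite h addrK !csmulA.
rewrite csmulBl !csmulBr !csmulBl csmulZr csmulZl !csmulA scaler_nat mulr2n.
set x := b' ** q ** b; set z := b' ** q ** q ** b.
have e : - (x - z) + (x + x - z) = x.
  by rewrite opprB -(addrA x x) [LHS]addrA subrK addrC subrK.
by rewrite -addrA e subrK.
Qed.

(** The root 1 - y of 1 - a^2 is built in [A], where the norm of [a] is controlled, and its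
    relations pass to [B]. The two unitaries, for [k] = i and -i, applied to f(a) give vectors of
    norm |f(a)| whose sum is 2 f(a)^2; hence |f(a)|^2 <= |f(a)|. *)
Lemma star_hom_selfadjoint (A B : cstarAlgType R) (f : A -> B) (a : A) (r : R) :
  star_hom f -> star a = a -> 0 <= r < 1 -> `|a| <= r%:C -> `|f a| <= 1.
Proof.
move=> [lf mf sf] sa /[dup] r01 /andP[r0 r1] ar.
have aar : `|a ** a| <= r%:C.
  rewrite (le_trans (normr_csmul _ _))// (le_trans (ler_pM _ _ ar ar))//.
  by rewrite -rmorphM lecR ler_piMl// ltW.
have [y yr hy] := half_square_fixpoint r01 aar.
have sy : star y = y.
  apply/eqP; rewrite -subr_eq0; apply/eqP.
  apply: (@contracted_eq0 _ _ y (star y) r r1) => //; first by rewrite norm_star.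
  have := congr1 star hy; rewrite starZ starD !starM sa rmorph_nat => hsy.
  by rewrite scalerBr hy hsy csmulBl csmulBr [RHS]addrC subrKA opprD addrACA subrr add0r.
have cy : a ** y = y ** a.
  apply/eqP; rewrite -subr_eq0; apply/eqP.
  apply: (@contracted_eq0 _ _ y y r r1) => //.
  rewrite scalerBr -csmulZr -csmulZl hy csmulDr csmulDl opprD addrACA csmulA.
  by rewrite subrr add0r csmulBl csmulBr !csmulA subrKA.
have f0 k x : f (k *: x) = k *: f x.
  have f00 : f 0 = 0.
    by have := lf (-1) 0 0; rewrite scaler0 addr0 scaleN1r addNr.
  by rewrite -[k *: x]addr0 lf f00 addr0.
have fD x z : f (x + z) = f x + f z by rewrite -[x]scale1r lf !scale1r.
have hp : 2%:R *: f y = f a ** f a + f y ** f y by rewrite -f0 hy fD !mf.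
have ps : star (f a) = f a by rewrite -sf sa.
have qs : star (f y) = f y by rewrite -sf sy.
have pq : f a ** f y = f y ** f a by rewrite -!mf cy.
have ic : (('i%C : R[i])^*)%C = - 'i%C.
  by apply/eqP; rewrite eq_complex /= oppr0 !eqxx.
have ii : 'i%C * 'i%C = -1 :> R[i] by rewrite -expr2 sqr_i.
have nic : ((- 'i%C : R[i])^*)%C = - - 'i%C.
  by apply/eqP; rewrite eq_complex /= !oppr0 !eqxx.
have nii : - 'i%C * - 'i%C = -1 :> R[i] by rewrite mulrNN.
have u1 := norm_unitary_mul (f a) ps qs pq hp ic ii.
have u2 := norm_unitary_mul (f a) ps qs pq hp nic nii.
have : `|2%:R *: (f a ** f a)| <= 2%:R * `|f a|.
  set c := f a ** f a; set d := f a - f y ** f a in u1 u2.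
  have -> : 2%:R *: c = (c + 'i%C *: d) + (c + - 'i%C *: d).
    by rewrite scaleNr addrACA subrr addr0 scaler_nat mulr2n.
  by rewrite (le_trans (ler_normD _ _))// u1 u2 mulr_natl.
rewrite normrZ normr_nat ler_pM2l ?ltr0n// -{1}ps normr_cstar.
have [->|fa0] := eqVneq `|f a| 0; first by rewrite ler01.
by rewrite expr2 -{3}[`|f a|]mul1r ler_pM2r// lt0r fa0 normr_ge0.
Qed.

Lemma linear_map0 (A B : cstarAlgType R) (f : A -> B) : linear f -> f 0 = 0.
Proof. by move=> lf; have := lf (-1) 0 0; rewrite scaler0 addr0 scaleN1r addNr. Qed.

Lemma star_hom_contractive (A B : cstarAlgType R) (f : A -> B) (a : A) :
  star_hom f -> `|f a| <= `|a|.
Proof.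
move=> hf; have [lf mf sf] := hf.
have lZ k x : f (k *: x) = k *: f x.
  by rewrite -[k *: x]addr0 lf (linear_map0 lf) addr0.
(* By the C*-identity, |f(a)|^2 is the norm of f(a* a), the image of a self-adjoint element. *)
suff sa_le b : star b = b -> `|f b| <= `|b|.
  rewrite -(@ler_pXn2r _ 2) ?nnegrE// -!normr_cstar -sf -mf.
  by apply: sa_le; rewrite starM starK.
move=> sb; have [r r0 Er] := normc_realE b; rewrite Er.
apply: lec_addgt0P => e e0; have re : 0 < r + e by rewrite ltr_wpDl.
(* Dividing by |b| + e instead of |b| makes the norm strictly less than 1 and covers b = 0. *)
pose c := (r + e)^-1; have c0 : 0 < c by rewrite invr_gt0.
have nk : `|c%:C : R[i]| = c%:C by rewrite ger0_norm// ler0c ltW.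
have := @star_hom_selfadjoint A B f (c%:C *: b) (c * r) hf.
rewrite starZ sb conjc_real lZ !normrZ nk Er -realcM.
have [s s0 ->] := normc_realE (f b); rewrite -realcM !lecR => h.
rewrite -[r + e]mulr1 -ler_pdivrMl//.
apply: h => //; rewrite mulr_ge0 ?(ltW c0)//= ltr_pdivrMl// mulr1.
by rewrite ltrDl.
Qed.

End star_hom_contractive.

(** * Isomorphic correspondences have isomorphic relative Cuntz-Pimsner algebras *)

Section continuous_maps.
Context {R : realType}.

Lemma lipschitz_continuous (V W : normedModType R[i]) (C : R) (f : V -> W) :
  (forall x y, `|f x - f y| <= C%:C * `|x - y|) -> continuous f.
Proof.
move=> hf x; apply/cvgrPdist_lt => _ /ltc0_real[e e0 ->].
have C0 : 0 < `|C| + 1 by rewrite ltr_wpDl.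
have d0 : 0 < (e / (`|C| + 1))%:C :> R[i] by rewrite ltcR divr_gt0.
have /cvgrPdist_lt/(_ _ d0) := @cvg_id _ (nbhs x).
apply: filterS => y; have [s s0 Es] := normc_realE (x - y).
rewrite Es ltcR ltr_pdivlMr// => h.
rewrite (le_lt_trans (hf x y))// Es -realcM ltcR (le_lt_trans _ h)//.
by rewrite mulrC ler_wpM2l// (le_trans (ler_norm C))// lerDl.
Qed.

Lemma continuous_compose (S T T' : topologicalType) (f : S -> T) (g : T -> T') :
  continuous f -> continuous g -> continuous (fun x => g (f x)).
Proof. by move=> cf cg x; apply: (continuous_comp (cf x)); exact: cg. Qed.

Lemma closed_eqfun (T : topologicalType) (W : normedModType R[i]) (f g : T -> W) :
  continuous f -> continuous g -> closed [set x | f x = g x].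
Proof.
move=> cf cg; have -> : [set x | f x = g x] = (f \- g) @^-1` [set 0].
  by apply/seteqP; split => x /= => [->|/eqP]; rewrite ?subrr// subr_eq0 => /eqP.
apply: (@preimage_closed _ _ (f \- g)).
  by move=> x _; apply: cvgB; [exact: cf|exact: cg].
by apply: accessible_closed_set1; apply: hausdorff_accessible; exact: norm_hausdorff.
Qed.

Lemma dense_eq (T : topologicalType) (W : normedModType R[i]) (D : set T)
    (f g : T -> W) : closure D = setT -> continuous f -> continuous g ->
  {in D, f =1 g} -> f =1 g.
Proof.
move=> dD cf cg fg x; have /closure_id e := closed_eqfun cf cg.
suff : [set x | f x = g x] x by [].
rewrite e; have : closure D x by rewrite dD.
by apply: closureS => y Dy /=; apply: fg; rewrite inE.
Qed.

Lemma star_hom_continuous (A B : cstarAlgType R) (f : A -> B) :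
  star_hom f -> continuous f.
Proof.
move=> hf; apply: (@lipschitz_continuous _ _ 1) => x y.
have [lf _ _] := hf; rewrite mul1r.
have -> : f x - f y = f (x - y).
  by have := lf (-1) y x; rewrite !scaleN1r !(addrC (- _)).
exact: star_hom_contractive.
Qed.

Lemma star_hom_comp (A B C : cstarAlgType R) (g : B -> C) (f : A -> B) :
  star_hom f -> star_hom g -> star_hom (g \o f).
Proof.
move=> [lf mf sf] [lg mg sg]; split.
- by move=> k x y /=; rewrite lf lg.
- by move=> x y /=; rewrite mf mg.
- by move=> x /=; rewrite sf sg.
Qed.

(** The equalizer of [f] and [g] is a star-subalgebra, closed because *-homomorphisms are
    automatically continuous, so [generates] applies to it. *)
Lemma generates_star_hom_eq (A B : cstarAlgType R) (G : set A) (f g : A -> B) :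
  generates G -> star_hom f -> star_hom g -> {in G, f =1 g} -> f =1 g.
Proof.
move=> gG hf hg fg x; have [[lf mf sf] [lg mg sg]] := (hf, hg).
suff : [set x | f x = g x] = setT by rewrite predeqE => /(_ x)[_]; exact.
apply: gG.
- exact: closed_eqfun (star_hom_continuous hf) (star_hom_continuous hg).
- split => /=; first by rewrite !linear_map0.
  + by move=> k a b; rewrite lf lg => -> ->.
  + by move=> a b; rewrite mf mg => -> ->.
  + by move=> a; rewrite sf sg => ->.
- by move=> a Ga; apply: fg; rewrite inE.
Qed.

End continuous_maps.

Section correspondence_isomorphism.
Context {R : realType}.

(** Both inverses belong to the data, so that [corr_iso_sym] turns each transport statement into its
    converse. Isometry of [U] is a consequence of [ci_inner]. *)
Record corr_iso (A A' : cstarAlgType R) (E : corrType A) (E' : corrType A')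
    (al : A -> A') (be : A' -> A) (U : E -> E') (V : E' -> E) : Prop := CorrIso {
  ci_al : star_hom al;
  ci_be : star_hom be;
  ci_alK : cancel al be;
  ci_beK : cancel be al;
  ci_U : linear U;
  ci_V : linear V;
  ci_UK : cancel U V;
  ci_VK : cancel V U;
  ci_inner : forall x y, hinner (U x) (U y) = al (hinner x y);
  ci_lact : forall a x, U (lact a x) = lact (al a) (U x);
  ci_ract : forall a x, U (ract x a) = ract (U x) (al a)
}.

Lemma corr_iso_sym (A A' : cstarAlgType R) (E : corrType A) (E' : corrType A')
    al be (U : E -> E') (V : E' -> E) :
  corr_iso al be U V -> corr_iso be al V U.
Proof.
move=> [ha hb alK beK lU lV UK VK iU lU' rU]; split=> //.
- by move=> x y; rewrite -{2}(VK x) -{2}(VK y) iU alK.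
- by move=> a x; apply: (can_inj UK); rewrite VK lU' beK VK.
- by move=> a x; apply: (can_inj UK); rewrite VK rU beK VK.
Qed.

Section transport.
Context (A A' : cstarAlgType R) (E : corrType A) (E' : corrType A').
Context (al : A -> A') (be : A' -> A) (U : E -> E') (V : E' -> E).
Hypothesis iso : corr_iso al be U V.

(** The map [al] is isometric because it and its inverse are contractive, and the norm of a Hilbert
    module is read off its inner product. *)
Lemma corr_iso_norm x : `|U x| = `|x|.
Proof.
have e : `|U x| ^+ 2 = `|x| ^+ 2.
  rewrite !normr_hinner (ci_inner iso); apply/eqP; rewrite eq_le.
  rewrite (star_hom_contractive _ (ci_al iso)) /=.
  rewrite -{1}(ci_alK iso (hinner x x)).
  exact: star_hom_contractive (ci_be iso).
by apply/eqP; rewrite -(@eqrXn2 _ 2)// e.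
Qed.

Lemma corr_isoD x y : U (x + y) = U x + U y.
Proof. by have := ci_U iso 1 x y; rewrite !scale1r. Qed.

Lemma corr_iso0 : U 0 = 0.
Proof. by apply/normr0_eq0; rewrite corr_iso_norm normr0. Qed.

Lemma corr_isoB x y : U (x - y) = U x - U y.
Proof. by have := ci_U iso (-1) y x; rewrite !scaleN1r !(addrC (- _)). Qed.

Definition transport_op (S : E -> E) : E' -> E' := U \o S \o V.

Lemma transport_theta x y : transport_op (theta x y) = theta (U x) (U y).
Proof.
apply/funext => z; rewrite /transport_op /theta /= (ci_ract iso).
by rewrite -(ci_inner iso) (ci_VK iso).
Qed.

Lemma transport_lact a : transport_op (lact a) = lact (al a).
Proof.
by apply/funext => z; rewrite /transport_op /= (ci_lact iso) (ci_VK iso).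
Qed.

Lemma transport_adjoint S S' :
  is_adjoint S S' -> is_adjoint (transport_op S) (transport_op S').
Proof.
move=> h x y; rewrite /transport_op /= -{2}(ci_VK iso x) -{1}(ci_VK iso y).
by rewrite !(ci_inner iso) h.
Qed.

Lemma transport_finite_rank S : finite_rank S -> finite_rank (transport_op S).
Proof.
move=> [n [c [x [y h]]]]; exists n, c, (U \o x), (U \o y) => z.
rewrite /transport_op /= h (big_morph U corr_isoD corr_iso0).
apply: eq_bigr => i _ /=; rewrite -transport_theta /transport_op /=.
by have := ci_U iso (c i) (theta (x i) (y i) (V z)) 0; rewrite corr_iso0 !addr0.
Qed.

Lemma transport_compact S : compact_op S -> compact_op (transport_op S).
Proof.
move=> [[S' aS] cS]; split; first by exists (transport_op S'); exact: transport_adjoint.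
move=> e /cS[F fF h]; exists (transport_op F); first exact: transport_finite_rank.
move=> z; rewrite /transport_op /= -corr_isoB corr_iso_norm (le_trans (h _))//.
by rewrite -corr_iso_norm (ci_VK iso).
Qed.

Lemma corr_iso_J a : corr_J E a -> corr_J E' (al a).
Proof. by rewrite /corr_J /= -transport_lact; exact: transport_compact. Qed.

Lemma corr_iso_ker a : corr_ker E a -> corr_ker E' (al a).
Proof.
by move=> h x; rewrite -(ci_VK iso x) -(ci_lact iso) h corr_iso0.
Qed.

Lemma pullback_representation (B : cstarAlgType R) (T : E' -> B) (pi : A' -> B) :
  representation T pi -> representation (T \o U) (pi \o al).
Proof.
move=> [lT hpi iT aT]; split.
- by move=> k x y /=; rewrite (ci_U iso) lT.
- exact: star_hom_comp (ci_al iso) hpi.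
- by move=> x y /=; rewrite iT (ci_inner iso).
- by move=> a x /=; rewrite (ci_lact iso) aT.
Qed.

(** Conjugation by [U] sends [theta x y] to [theta (U x) (U y)] and [lact a] to [lact (al a)], so
    composing [Psi] with it gives the homomorphism induced by [T \o U]. *)
Lemma pullback_coisometric (K : set A) (K' : set A') (B : cstarAlgType R)
    (T : E' -> B) (pi : A' -> B) : (forall a, K a -> K' (al a)) ->
  coisometric K' T pi -> coisometric K (T \o U) (pi \o al).
Proof.
move=> KK' [Psi [Pt Pl Pm Pa] PK]; exists (Psi \o transport_op); last first.
  by move=> a Ka /=; rewrite transport_lact PK//; exact: KK'.
split => /=.
- by move=> x y; rewrite transport_theta Pt.
- move=> k S S' cS cS'.
  rewrite -Pl; [|exact: transport_compact|exact: transport_compact].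
  by congr Psi; apply/funext => z; rewrite /transport_op /= (ci_U iso).
- move=> S S' cS cS'.
  rewrite -Pm; [|exact: transport_compact|exact: transport_compact].
  by congr Psi; apply/funext => z; rewrite /transport_op /= (ci_UK iso).
- move=> S S' cS aS; apply: Pa; first exact: transport_compact.
  exact: transport_adjoint.
Qed.

Lemma pullback_cuntz_pimsner (K : set A) (K' : set A')
    (O : relative_cuntz_pimsner E K) (O' : relative_cuntz_pimsner E' K') :
  (forall a, K a -> K' (al a)) ->
  exists rho : O -> O', [/\ star_hom rho,
    (forall x, rho (cp_T O x) = cp_T O' (U x)) &
    (forall a, rho (cp_pi O a) = cp_pi O' (al a))].
Proof.
move=> KK'; apply: cp_universal.
  exact: pullback_representation (cp_representation O').
exact: pullback_coisometric KK' (cp_coisometric O').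
Qed.

End transport.

Lemma corr_iso_katsura (A A' : cstarAlgType R) (E : corrType A)
    (E' : corrType A') al be (U : E -> E') (V : E' -> E) a :
  corr_iso al be U V -> katsura_ideal E a -> katsura_ideal E' (al a).
Proof.
move=> iso [Ja anna]; split; first exact: corr_iso_J iso _ Ja.
(* The annihilator condition tests against the kernel on the [E'] side, so [b] is carried back by
   [be] before the hypothesis on [a] applies. *)
move=> b kb; have := anna _ (corr_iso_ker (corr_iso_sym iso) kb).
have [la ma _] := ci_al iso.
by move=> /(congr1 al); rewrite ma (ci_beK iso) (linear_map0 la).
Qed.

Lemma cuntz_pimsner_isomorphic (A A' : cstarAlgType R) (E : corrType A)
    (E' : corrType A') al be (U : E -> E') (V : E' -> E) (K : set A) (K' : set A')
    (O : relative_cuntz_pimsner E K) (O' : relative_cuntz_pimsner E' K') :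
  corr_iso al be U V ->
  (forall a, K a -> K' (al a)) -> (forall a, K' a -> K (be a)) ->
  cstar_isomorphic O O'.
Proof.
move=> iso KK' K'K; have osi := corr_iso_sym iso.
have [rho [hr rT rpi]] := pullback_cuntz_pimsner iso O O' KK'.
have [rho' [hr' rT' rpi']] := pullback_cuntz_pimsner osi O' O K'K.
have idh (B : cstarAlgType R) : star_hom (@id B) by split.
exists rho => //; exists rho'.
  suff : rho' \o rho =1 id by [].
  apply: generates_star_hom_eq (@cp_generates _ _ _ _ O) (star_hom_comp hr hr') (idh _) _.
  move=> x; rewrite inE => -[] [y _ <-] /=; first by rewrite rT rT' (ci_UK iso).
  by rewrite rpi rpi' (ci_alK iso).
suff : rho \o rho' =1 id by [].
apply: generates_star_hom_eq (@cp_generates _ _ _ _ O') (star_hom_comp hr' hr) (idh _) _.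
move=> x; rewrite inE => -[] [y _ <-] /=; first by rewrite rT' rT (ci_VK iso).
by rewrite rpi' rpi (ci_beK iso).
Qed.

End correspondence_isomorphism.

(** * Extension of isometries from dense subspaces *)

Section isometric_extension.
Context {R : realType}.

(** The map is prescribed on a family [i f] and not on a subset of [V]: [i] need not be injective,
    and equality of distances alone makes the assignment of [j f] to [i f] well defined. *)
Lemma isometric_extension (V W : completeNormedModType R[i]) (I : Type)
    (P : set I) (i : I -> V) (j : I -> W) :
  closure (i @` P) = setT ->
  (forall f g, P f -> P g -> `|j f - j g| = `|i f - i g|) ->
  exists U : V -> W, (forall x y, `|U x - U y| = `|x - y|) /\
    (forall f, P f -> U (i f) = j f).
Proof.
move=> dP ij.
have near x (e : R) : 0 < e -> exists2 f, P f & `|x - i f| < e%:C.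
  move=> e0; have : closure (i @` P) x by rewrite dP.
  have e0' : 0 < e%:C :> R[i] by rewrite ltcR.
  move=> /(_ _ (nbhsx_ballx x _ e0')) [_ [[f Pf <-]]].
  by rewrite -ball_normE /= => h; exists f.
have ex x : exists z, forall e : R, 0 < e ->
    exists f, [/\ P f, `|x - i f| <= e%:C & `|z - j f| <= e%:C].
  (* The value at [x] is the limit of [j f] as [i f] tends to [x]. The filter generated by these
     sets is Cauchy because [j] reproduces the distances of [i]. *)
  pose B (e : R) := j @` [set f | P f /\ `|x - i f| < e%:C].
  pose F := filter_from [set e : R | 0 < e] B.
  have FF : ProperFilter F.
    apply: filter_from_proper; last first.
      by move=> e /(near x)[f Pf xf]; exists (j f); exists f.
    apply: filter_from_filter; first by exists 1; exact: ltr01.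
    move=> e1 e2 /= e10 e20; exists (Num.min e1 e2).
      by rewrite /= lt_min e10.
    move=> _ [f [Pf xf] <-]; split; exists f => //; split => //.
      by rewrite (lt_le_trans xf)// lecR ge_min lexx.
    by rewrite (lt_le_trans xf)// lecR ge_min lexx orbT.
  have /cvg_ex[z Fz] : cvg F.
    apply: cauchy_cvg; apply/cauchy_ballP => _ /ltc0_real[e e0 ->].
    have e2 : 0 < e / 2 by rewrite divr_gt0.
    exists (B (e / 2), B (e / 2)) => /=; first by split; exists (e / 2).
    move=> [_ _] /= [[f [Pf xf] <-] [g [Pg xg] <-]]; rewrite -ball_normE /= ij//.
    rewrite -(subrKA x) (le_lt_trans (ler_normD _ _))// (splitr e) realcD.
    by rewrite ltrD// distrC.
  exists z => e e0; have e0' : 0 < e%:C :> R[i] by rewrite ltcR.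
  have [d /= d0 Bd] := Fz _ (nbhsx_ballx z _ e0').
  have [|f Pf xf] := near x (Num.min d e); first by rewrite lt_min d0.
  exists f; split => //.
    by rewrite (le_trans (ltW xf))// lecR ge_min lexx orbT.
  have : ball z e%:C (j f).
    apply: Bd; exists f => //; split => //.
    by rewrite (lt_le_trans xf)// lecR ge_min lexx.
  by rewrite -ball_normE /= => /ltW.
have [U hU] := choice ex; exists U; split => [x y|f Pf]; last first.
  apply/eqP; rewrite -subr_eq0; apply/eqP/norm_le_gt0_eq0 => e e0.
  have e2 : 0 < e / 2 by rewrite divr_gt0.
  have [g [Pg fg Ug]] := hU (i f) _ e2.
  rewrite -(subrKA (j g)) (le_trans (ler_normD _ _))// (splitr e) realcD.
  by rewrite lerD// ij// distrC.
(* Distances are compared along the chains [U x], [j f], [j g], [U y] and [i f], [x], [y], [i g].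
   Four approximations enter, each costing e/4. *)
have e4 (e : R) : 0 < e -> 0 < e / 4 by move=> e0; rewrite divr_gt0.
have [r r0 Er] := normc_realE (x - y); have [s s0 Es] := normc_realE (U x - U y).
have tri (T : normedModType R[i]) (a b c d : T) (u v w : R) :
    `|a - b| <= u%:C -> `|b - c| <= v%:C -> `|c - d| <= w%:C ->
    `|a - d| <= (u + v + w)%:C.
  move=> h1 h2 h3; rewrite -(subrKA c) -(subrKA b a (- c)) !realcD.
  by rewrite (le_trans (ler_normD _ _))// lerD// (le_trans (ler_normD _ _))// lerD.
have split4 (e t : R) : e / 4 + (e / 4 + t + e / 4) + e / 4 = t + e by lra.
apply/eqP; rewrite eq_le; apply/andP; split.
  rewrite Er; apply: lec_addgt0P => e /e4 e0.
  have [f [Pf xf Uf]] := hU x _ e0; have [g [Pg yg Ug]] := hU y _ e0.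
  rewrite -split4; apply: (tri _ _ _ _ _ _ _ _ Uf _ (_ : `|j g - U y| <= _)).
    rewrite ij//; apply: (tri _ _ _ _ _ _ _ _ _ (_ : `|x - y| <= _) yg).
      by rewrite distrC.
    by rewrite Er.
  by rewrite distrC.
rewrite Es; apply: lec_addgt0P => e /e4 e0.
have [f [Pf xf Uf]] := hU x _ e0; have [g [Pg yg Ug]] := hU y _ e0.
rewrite -split4; apply: (tri _ _ _ _ _ _ _ _ xf _ (_ : `|i g - y| <= _)).
  rewrite -ij//; apply: (tri _ _ _ _ _ _ _ _ _ (_ : `|U x - U y| <= _) Ug).
    by rewrite distrC.
  by rewrite Es.
by rewrite distrC.
Qed.

End isometric_extension.

(** * Polarization and continuity of the inner product *)

Section inner_product.
Context {R : realType} {A : cstarAlgType R} {E : hilbertModType A}.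
Implicit Types x y z : E.

Lemma hinnerBr x y z : hinner x (y - z) = hinner x y - hinner x z.
Proof. by rewrite hinnerDr -scaleN1r hinnerZr scaleN1r. Qed.

Lemma hinnerBl x y z : hinner (x - y) z = hinner x z - hinner y z.
Proof. by rewrite -star_hinner hinnerBr starB !star_hinner. Qed.

Lemma hinnerDl x y z : hinner (x + y) z = hinner x z + hinner y z.
Proof. by rewrite -star_hinner hinnerDr starD !star_hinner. Qed.

Lemma hinnerZl (k : R[i]) x y : hinner (k *: x) y = (k^*)%C *: hinner x y.
Proof. by rewrite -star_hinner hinnerZr starZ star_hinner. Qed.

(** Each bracket equals <x,z> + <z,x>, for z = y and z = iy. Multiplied by -i, the second becomes
    <x,y> - <y,x>, which cancels the unwanted term of the first. *)
Lemma hinner_polarization x y : 2%:R *: hinner x y =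
  (hinner (x + y) (x + y) - hinner x x - hinner y y) -
  'i%C *: (hinner (x + 'i%C *: y) (x + 'i%C *: y) - hinner x x -
           hinner ('i%C *: y) ('i%C *: y)).
Proof.
have e z : hinner (x + z) (x + z) - hinner x x - hinner z z =
    hinner x z + hinner z x.
  rewrite hinnerDl !hinnerDr; set a := hinner x x.
  rewrite -(addrA a) (addrC a) addrK.
  by rewrite !addrA addrK.
rewrite !e hinnerZr hinnerZl scalerDr !scalerA -expr2 sqr_i.
have -> : 'i%C * (('i%C : R[i])^*)%C = 1.
  by apply/eqP; rewrite eq_complex /=; apply/andP; split; apply/eqP; lra.
rewrite scaleN1r scale1r opprD opprK addrACA subrr addr0.
by rewrite scaler_nat mulr2n.
Qed.

(* Weaker than Cauchy-Schwarz, but immediate from polarization. *)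
Lemma norm_hinner x y : `|hinner x y| <= 6%:R * `|x| * `|y|.
Proof.
have unit_bound (u v : E) : `|u| = 1 -> `|v| = 1 -> `|hinner u v| <= 6%:R.
  move=> u1 v1; have q z : `|z| = 1 ->
      `|hinner (u + z) (u + z) - hinner u u - hinner z z| <= 6%:R.
    (* For unit vectors a bracket is at most |u + z|^2 + |u|^2 + |z|^2 <= 4 + 1 + 1. Two brackets
       against the factor 2 of the polarization leave the constant 6. *)
    move=> z1; have -> : 6%:R = 2%:R ^+ 2 + 1 + 1 :> R[i].
      by rewrite -natrX !natr1.
    rewrite (le_trans (ler_normB _ _))// lerD//; last first.
      by rewrite -normr_hinner z1 expr1n.
    rewrite (le_trans (ler_normB _ _))// lerD//; last first.
      by rewrite -normr_hinner u1 expr1n.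
    rewrite -normr_hinner ler_pXn2r ?nnegrE//.
    by rewrite (le_trans (ler_normD _ _))// u1 z1.
  have ni : `|'i%C : R[i]| = 1.
    by rewrite normc_def /= expr0n /= add0r expr1n sqrtr1.
  have n2 : 0 < 2%:R :> R[i] by rewrite ltr0n.
  rewrite -(ler_pM2l n2) -{1}(normr_nat R[i] 2) -normrZ hinner_polarization.
  rewrite mulr_natl mulr2n; apply: le_trans (ler_normB _ _) _.
  apply: lerD; first exact: q.
  by rewrite normrZ ni mul1r q// normrZ ni mul1r.
have [->|x0] := eqVneq x 0.
  by have := hinnerBl x x y; rewrite !subrr => ->; rewrite !normr0 mulr0 mul0r.
have [->|y0] := eqVneq y 0.
  by have := hinnerBr x y y; rewrite !subrr => ->; rewrite !normr0 mulr0.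
have nx : 0 < `|x| by rewrite normr_gt0.
have ny : 0 < `|y| by rewrite normr_gt0.
have unit (z : E) : 0 < `|z| -> `| `|z|^-1 *: z| = 1.
  by move=> z0; rewrite normrZ normfV normr_id mulVf// gt_eqF.
have := unit_bound _ _ (unit _ nx) (unit _ ny).
rewrite hinnerZr hinnerZl !normrZ norm_conjC !normfV !normr_id.
by rewrite ler_pdivrMl// ler_pdivrMl// mulrCA mulrC mulrAC mulrC mulrA.
Qed.

Lemma hinnerr_continuous x : continuous (hinner x : E -> A).
Proof.
have [r r0 Er] := normc_realE x.
apply: (@lipschitz_continuous _ _ _ (6%:R * r)) => y z.
by rewrite -hinnerBr realcM rmorph_nat -Er norm_hinner.
Qed.

Lemma hinnerl_continuous y : continuous (fun x : E => hinner x y : A).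
Proof.
have [r r0 Er] := normc_realE y.
apply: (@lipschitz_continuous _ _ _ (6%:R * r)) => x z.
by rewrite -hinnerBl realcM rmorph_nat -Er mulrAC norm_hinner.
Qed.

(** By continuity the test extends from [D] to z = x - y. Identities involving [lact] and [ract] are
    reduced in this way to inner products, with no continuity of the actions. *)
Lemma hinner_dense_inj (D : set E) x y : closure D = setT ->
  (forall z, D z -> hinner z x = hinner z y) -> x = y.
Proof.
move=> dD h; apply/eqP; rewrite -subr_eq0 -normr_eq0 -sqrf_eq0 normr_hinner.
rewrite normr_eq0 hinnerBr subr_eq0; apply/eqP.
have e := dense_eq dD (@hinnerl_continuous x) (@hinnerl_continuous y).
by apply: e => z; rewrite inE; exact: h.
Qed.

End inner_product.

Section dense_isomorphism.
Context {R : realType}.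

Lemma inner_product_extension (A A' : cstarAlgType R) (E : hilbertModType A)
    (E' : hilbertModType A') (al : A -> A') (I : lmodType R[i]) (P : set I)
    (i : I -> E) (j : I -> E') :
  star_hom al -> (forall a, `|al a| = `|a|) ->
  closure (i @` P) = setT ->
  (forall (k : R[i]) f g, P f -> P g -> P (k *: f + g)) ->
  (forall (k : R[i]) f g, P f -> P g -> i (k *: f + g) = k *: i f + i g) ->
  (forall (k : R[i]) f g, P f -> P g -> j (k *: f + g) = k *: j f + j g) ->
  (forall f g, P f -> P g -> hinner (j f) (j g) = al (hinner (i f) (i g))) ->
  exists U : E -> E', [/\ linear U, continuous U,
    (forall f, P f -> U (i f) = j f) &
    (forall x y, hinner (U x) (U y) = al (hinner x y))].
Proof.
move=> hal nal dP lP li lj ij.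
have iB f g : P f -> P g -> i f - i g = i ((-1) *: g + f).
  by move=> Pf Pg; rewrite li// scaleN1r addrC.
have jB f g : P f -> P g -> j f - j g = j ((-1) *: g + f).
  by move=> Pf Pg; rewrite lj// scaleN1r addrC.
have dist f g : P f -> P g -> `|j f - j g| = `|i f - i g|.
  move=> Pf Pg; rewrite iB// jB//; have Ph := lP (-1) _ _ Pg Pf.
  by apply/eqP; rewrite -(@eqrXn2 _ 2)// !normr_hinner ij// nal.
have [U [Ud Ui]] := isometric_extension dP dist.
have cU : continuous U.
  by apply: (@lipschitz_continuous _ _ _ 1) => x y; rewrite mul1r Ud.
have dP' D : D = i @` P -> forall z, z \in D -> exists2 f, P f & z = i f.
  by move=> -> z; rewrite inE => -[f Pf <-]; exists f.
exists U; split=> //.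
- move=> k x y.
  have c1 (T : normedModType R[i]) (u v : E -> T) : continuous u ->
      continuous v -> continuous (fun z => u z + v z).
    by move=> cu cv z; apply: cvgD; [exact: cu|exact: cv].
  have c2 (T : normedModType R[i]) (u : E -> T) : continuous u ->
      continuous (fun z => k *: u z).
    by move=> cu z; apply: cvgZl_tmp; exact: cu.
  have cst (T : normedModType R[i]) (a : T) : continuous (fun _ : E => a).
    by move=> z; exact: cvg_cst.
  have cid : continuous (fun z : E => z) by move=> z; exact: cvg_id.
  (* Linearity, like the inner product formula afterwards, is extended from the dense family one
     variable at a time. *)
  have h f : P f -> forall z, U (k *: z + i f) = k *: U z + U (i f).
    move=> Pf; apply: (dense_eq dP).
    + by apply: (continuous_compose (@c1 _ _ (fun=> _) (@c2 _ _ cid) (@cst _ _)) cU).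
    + exact: (@c1 _ _ (fun=> _) (@c2 _ _ cU) (@cst _ _)).
    + by move=> _ /(dP' _ erefl)[g Pg ->]; rewrite -li// !Ui ?lj//; exact: lP.
  have : (fun z => U (k *: x + z)) =1 (fun z => k *: U x + U z).
    apply: (dense_eq dP).
    + exact: (continuous_compose (@c1 _ (fun=> _) _ (@cst _ _) cid) cU).
    + exact: (@c1 _ (fun=> _) _ (@cst _ _) cU).
    + by move=> _ /(dP' _ erefl)[g Pg ->]; exact: h.
  exact.
- have cal := star_hom_continuous hal.
  have h f : P f -> forall z, hinner (U z) (j f) = al (hinner z (i f)).
    move=> Pf; apply: (dense_eq dP).
    + exact: continuous_compose cU (@hinnerl_continuous _ _ _ (j f)).
    + exact: continuous_compose (@hinnerl_continuous _ _ _ (i f)) cal.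
    + by move=> _ /(dP' _ erefl)[g Pg ->]; rewrite Ui// ij.
  move=> x; apply: (dense_eq dP).
  + exact: continuous_compose cU (@hinnerr_continuous _ _ _ (U x)).
  + exact: continuous_compose (@hinnerr_continuous _ _ _ x) cal.
  + by move=> _ /(dP' _ erefl)[g Pg ->]; rewrite Ui// h.
Qed.

Lemma corr_iso_of_dense (A A' : cstarAlgType R) (E : corrType A)
    (E' : corrType A') (al : A -> A') (be : A' -> A) (I I' : lmodType R[i])
    (P : set I) (P' : set I') (i : I -> E) (i' : I' -> E')
    (w : I -> I') (w' : I' -> I) :
  star_hom al -> star_hom be -> cancel al be -> cancel be al ->
  closure (i @` P) = setT -> closure (i' @` P') = setT ->
  (forall (k : R[i]) f g, P f -> P g -> P (k *: f + g)) ->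
  (forall (k : R[i]) f g, P' f -> P' g -> P' (k *: f + g)) ->
  (forall (k : R[i]) f g, P f -> P g -> i (k *: f + g) = k *: i f + i g) ->
  (forall (k : R[i]) f g, P' f -> P' g -> i' (k *: f + g) = k *: i' f + i' g) ->
  linear w -> linear w' -> cancel w w' -> cancel w' w ->
  (forall f, P f -> P' (w f)) -> (forall f, P' f -> P (w' f)) ->
  (forall f g, P f -> P g ->
    hinner (i' (w f)) (i' (w g)) = al (hinner (i f) (i g))) ->
  (forall a f, P f -> exists2 f', P f' &
    lact a (i f) = i f' /\ lact (al a) (i' (w f)) = i' (w f')) ->
  exists U : E -> E', exists V, corr_iso al be U V.
Proof.
move=> hal hbe alK beK dP dP' lP lP' li li' lw lw' wK w'K Pw P'w ip la.
have nal a : `|al a| = `|a|.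
  apply/eqP; rewrite eq_le (star_hom_contractive _ hal) /=.
  by rewrite -{1}(alK a) (star_hom_contractive _ hbe).
have nbe a : `|be a| = `|a| by rewrite -nal beK.
have [||U [lU cU Ui Uh]] :=
    @inner_product_extension _ _ _ _ al _ P i (i' \o w) hal nal dP lP li.
- by move=> k f g Pf Pg /=; rewrite lw li'//; exact: Pw.
- by move=> f g Pf Pg /=; rewrite ip.
have [||V [lV cV Vi Vh]] :=
    @inner_product_extension _ _ _ _ be _ P' i' (i \o w') hbe nbe dP' lP' li'.
- by move=> k f g Pf Pg /=; rewrite lw' li//; exact: P'w.
- by move=> f g Pf Pg /=; rewrite -{2}(w'K f) -{2}(w'K g) ip ?alK//; exact: P'w.
have {}Ui f : P f -> U (i f) = i' (w f) by exact: Ui.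
have {}Vi f : P' f -> V (i' f) = i (w' f) by exact: Vi.
have UK : cancel U V.
  have cUV : continuous (V \o U).
    exact: continuous_compose cU cV.
  apply: (dense_eq dP cUV) => [z|z]; first exact: cvg_id.
  by rewrite inE => -[f Pf <-] /=; rewrite Ui// Vi/= ?wK//; exact: Pw.
have VK : cancel V U.
  have cVU : continuous (U \o V).
    exact: continuous_compose cV cU.
  apply: (dense_eq dP' cVU) => [z|z]; first exact: cvg_id.
  by rewrite inE => -[f Pf <-] /=; rewrite Vi// Ui/= ?w'K//; exact: P'w.
have [_ mal sal] := hal.
exists U, V; split => //.
(* Moving [a] across the inner product as [star a] puts the left action on the dense family, where
   the hypothesis [la] describes it. *)
- move=> a x; apply: (hinner_dense_inj dP') => _ [f Pf <-].
  have Pw'f := P'w _ Pf; rewrite -(w'K f).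
  have [f' Pf' [e1 e2]] := la (star a) _ Pw'f.
  transitivity (al (hinner (lact (star a) (i (w' f))) x)).
    by rewrite -Ui// Uh lact_adjoint starK.
  by rewrite e1 -Uh Ui// -e2 sal lact_adjoint starK.
(* The right action leaves the second variable of the inner product as a multiplication, which [al]
   respects. *)
- move=> a x; apply: (hinner_dense_inj dP') => _ [f Pf <-].
  rewrite -(w'K f) -Ui ?Uh; last exact: P'w.
  by rewrite !hinner_ractr mal Uh.
Qed.

End dense_isomorphism.

(** * Borel integrals and change of variables *)

Section borel_integrals.
Context {R : realType}.

Lemma borel_preimage (T T' : topologicalType) (psi : T -> T') (B : set T') :
  continuous psi -> borel B -> borel (psi @^-1` B).
Proof.
move=> cpsi; apply: (@smallest_sub _ _ _ [set B | borel (psi @^-1` B)]).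
  have [b0 bD bU] := smallest_sigma_algebra setT (@open T); split => /=.
  - by rewrite preimage_set0.
  - by move=> A /bD.
  - by move=> F /bU.
move=> U oU; apply: sub_sigma_algebra.
by apply: open_comp => // x _; exact: cpsi.
Qed.

Lemma closed_borel (T : topologicalType) (B : set T) : closed B -> borel B.
Proof.
move=> cB; have [_ bD _] := smallest_sigma_algebra setT (@open T).
rewrite -(setCK B) -setTD; apply: bD; apply: sub_sigma_algebra.
exact: closed_openC.
Qed.

Lemma continuous_borel_measurable (T : topologicalType) (t0 : T) (f : T -> R) :
  continuous f -> measurable_fun [set: borel_at t0] (f : borel_at t0 -> R).
Proof.
move=> cf; apply: (measurability _ (RGenOpens.measurableE R)).
move=> _ [_ [a [b ->]] <-]; rewrite setTI.
apply: (@borel_preimage T R^o f _ cf); apply: sub_sigma_algebra.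
exact: interval_open.
Qed.

Lemma borel_integralE (T : topologicalType) (mu : set T -> \bar R) (D : set T)
    (f : T -> \bar R) (t : T) : exists t0 : T, borel_integral mu D f =
  (\int[mu : set (borel_at t0) -> \bar R]_(x in D) f x)%E.
Proof.
rewrite /borel_integral; case: pselect => [ht|[]]; last by exists t.
by exists (projT1 (cid ht)).
Qed.

(** On Borel sets [nu] is the image of [c] times [mu] under [psi]. The nonnegative case is applied
    to the positive and negative parts separately, so no integrability is involved. *)
Lemma borel_integral_change (T T' : topologicalType) (mu : radon_measure R T)
    (nu : radon_measure R T') (psi : T -> T') (psi' : T' -> T) (c : R)
    (D : set T') (f : T' -> R) : continuous psi -> 0 < c ->
  (forall B, borel B -> nu B = (c%:E * mu (psi @^-1` B))%E) ->
  borel D -> continuous f ->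
  borel_integral nu D (EFin \o f) =
  borel_integral mu (psi @^-1` D) (fun x => (c * f (psi x))%:E).
Proof.
move=> cpsi c0 numu bD cf.
(* If [T'] is empty then so is [T], because of [psi], and both integrals are 0 by definition.
   Otherwise [psi'] supplies a point of [T]. *)
have [[t' _]|nT'] := pselect (exists t' : T', True); last first.
  rewrite /borel_integral; case: pselect => [ht'|_]; first by case: nT'.
  by case: pselect => [ht|//]; case: nT'; exists (psi (projT1 (cid ht))).
have [t0' ->] := borel_integralE nu D (EFin \o f) t'.
have [t0 ->] := borel_integralE mu (psi @^-1` D) (fun x => (c * f (psi x))%:E)
  (psi' t').
have mpsi : measurable_fun [set: borel_at t0] (psi : borel_at t0 -> borel_at t0').
  by move=> _ B mB; rewrite setTI; exact: borel_preimage.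
have mD : measurable (psi @^-1` D : set (borel_at t0)) by exact: borel_preimage.
have mf : measurable_fun (D : set (borel_at t0')) (EFin \o f).
  by apply: measurable_funTS; apply/measurable_EFinP; exact: continuous_borel_measurable.
have mfpsi : measurable_fun (psi @^-1` D : set (borel_at t0)) (EFin \o f \o psi).
  apply: measurable_funTS; apply/measurable_EFinP.
  by apply: continuous_borel_measurable; exact: continuous_compose.
have key (g : T' -> \bar R) : (forall x, 0 <= g x)%E ->
    measurable_fun (D : set (borel_at t0')) g ->
    measurable_fun (psi @^-1` D : set (borel_at t0)) (g \o psi) ->
    (\int[nu : set (borel_at t0') -> \bar R]_(x in D) g x =
     \int[mu : set (borel_at t0) -> \bar R]_(x in psi @^-1` D)
       (c%:E * g (psi x)))%E.
  move=> g0 mg mgpsi.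
  rewrite ge0_integralZl_EFin//; last exact: ltW.
  have := @ge0_integral_mscale _ (borel_at t0) R mu _ mD
    (NngNum (ltW c0)) _ mgpsi (fun x _ => g0 (psi x)).
  move=> /= <-.
  rewrite -(@ge0_integral_pushforward _ _ _ _ _ _ mpsi _ D g)//.
  by apply: eq_measure_integral => B mB _; exact: numu.
rewrite [LHS]integralE [RHS]integralE.
have -> : (fun x => (c * f (psi x))%:E) = (fun x => c%:E * (EFin \o f \o psi) x)%E.
  by apply/funext => x; rewrite /= EFinM.
rewrite ge0_funeposM ?(ltW c0)// ge0_funenegM ?(ltW c0)//.
have pos_comp : (EFin \o f \o psi)^\+%E = (EFin \o f)^\+%E \o psi by rewrite !unlock.
have neg_comp : (EFin \o f \o psi)^\-%E = (EFin \o f)^\-%E \o psi by rewrite !unlock.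
rewrite pos_comp neg_comp; congr (_ - _)%E; apply: key.
- by move=> x; exact: funepos_ge0.
- exact: measurable_funepos.
- by rewrite -pos_comp; exact: measurable_funepos.
- by move=> x; exact: funeneg_ge0.
- exact: measurable_funeneg.
- by rewrite -neg_comp; exact: measurable_funeneg.
Qed.

End borel_integrals.

(** * Bump functions and the positivity of their integrals *)

Section bump.
Context {R : realType}.

Lemma bump_function (T : topologicalType) (t : T) :
  locally_compact [set: T] -> hausdorff_space T ->
  exists f : T -> R, [/\ continuous f, (forall x, 0 <= f x <= 1), f t = 1 &
    compact (closure [set x | f x != 0])].
Proof.
move=> lT hT; have [U nU [pU cU]] := lT t I.
have tU : U° t by move: nU; rewrite withinET.
have cUi : closed (~` U°) by apply: open_closedC; exact: open_interior.
(* Complete regularity separates [t] from the complement of the interior of a compact neighbourhood.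
   The separating function vanishes at [t], so the bump is 1 minus it. *)
have : uniform_separator [set t] (~` U°).
  by apply: (@locally_compact_completely_regular T R lT hT) => //; rewrite setCK.
move=> /(@uniform_separatorP _ R)[f [cf f01 f0 f1]].
have sub : [set x | 1 - f x != 0] `<=` U.
  move=> x /= fx; apply: interior_subset; apply: contrapT => nUx.
  by move: fx; rewrite (f1 (f x)) ?subrr ?eqxx//; exists x.
exists (fun x => 1 - f x); split.
- by move=> x; apply: cvgB; [exact: cvg_cst|exact: cf].
- move=> x; have : (f @` setT) (f x) by exists x.
  by move=> /f01 /=; rewrite in_itv /= subr_ge0 gerBl andbC.
- by rewrite (f0 (f t)) ?subr0//; exists t.
- apply: (subclosed_compact (@closed_closure _ _) pU).
  by move/closure_id: cU => ->; exact: closureS.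
Qed.

(** The integral is at least half the measure of the open set where f > 1/2, which is positive as
    [t] lies in the support. It must also be bounded, by the measure of the compact [K], because
    [fine] would send an infinite value to 0. *)
Lemma bump_integral (T : topologicalType) (mu : radon_measure R T) (t : T)
    (f : T -> R) : hausdorff_space T -> measure_support mu t ->
  continuous f -> (forall x, 0 <= f x <= 1) -> f t = 1 ->
  compact (closure [set x | f x != 0]) ->
  0 < fine (borel_integral mu setT (EFin \o f)).
Proof.
move=> hT st cf f01 ft cK; set K := closure _ in cK.
have [t0 ->] := borel_integralE mu setT (EFin \o f) t.
have mf : measurable_fun [set: borel_at t0] (EFin \o f).
  by apply/measurable_EFinP; exact: continuous_borel_measurable.
have mK : measurable (K : set (borel_at t0)).
  by apply: closed_borel; exact: closed_closure.
pose U := f @^-1` [set x : R | 2^-1 < x].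
have oU : open U.
  by apply: open_comp => [x _|]; [exact: cf|exact: open_gt].
have mU : measurable (U : set (borel_at t0)) by exact: sub_sigma_algebra.
have f0 x : [set: borel_at t0] x -> (0 <= (EFin \o f) x)%E.
  by move=> _; rewrite lee_fin; case/andP: (f01 x).
have int_indic (A : set (borel_at t0)) : measurable A ->
    (\int[mu : set (borel_at t0) -> \bar R]_x (\1_A x)%:E)%E = mu A.
  by move=> mA; rewrite integral_indic// setIT.
apply: fine_gt0; apply/andP; split.
  apply: (@lt_le_trans _ _ (2^-1%:E * mu U)%E).
    rewrite mule_gt0//; apply: st; split => //=.
    by rewrite /U /= ft invf_lt1// ltr1n.
  rewrite -int_indic//.
  rewrite -ge0_integralZl_EFin//; last first.
    by apply/measurable_EFinP; exact: measurable_indic.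
  apply: ge0_le_integral => //.
  - apply/measurable_EFinP; apply: measurable_funM => //; exact: measurable_indic.
  - move=> x _; rewrite -EFinM lee_fin indicE.
    have [Ux|_] := boolP (x \in U); last by rewrite mulr0; case/andP: (f01 x).
    by rewrite mulr1; move: Ux; rewrite inE /U /= => /ltW.
apply: (@le_lt_trans _ _ (mu K)); last exact: radon_compact.
rewrite -int_indic//.
apply: ge0_le_integral => //.
  by apply/measurable_EFinP; exact: measurable_indic.
move=> x _; rewrite lee_fin indicE.
have [Kx|nKx] := boolP (x \in K); first by case/andP: (f01 x).
have [->//|fx] := eqVneq (f x) 0.
by move: nKx; rewrite notin_setE => -[]; exact: subset_closure.
Qed.

End bump.

(** * The correspondences of isomorphic quivers *)

Section compact_support.
Context {R : realType} {T : topologicalType}.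
Hypothesis hT : hausdorff_space T.
Implicit Types f g : T -> R[i].

Lemma Cc_of_compact f (K : set T) : continuous f -> compact K ->
  (forall x, f x != 0 -> K x) -> Cc f.
Proof.
move=> cf cK fK; split => //; apply: (subclosed_compact _ cK).
  exact: closed_closure.
have /closure_id -> : closed K by exact: compact_closed.
exact: closureS.
Qed.

Lemma Cc_linear (k : R[i]) f g : Cc f -> Cc g -> Cc (k *: f + g).
Proof.
move=> [cf Kf] [cg Kg]; apply: (Cc_of_compact _ (compactU Kf Kg)).
  by move=> x; apply: cvgD; [apply: cvgZl_tmp; exact: cf|exact: cg].
move=> x; have [fx|fx _] := eqVneq (f x) 0; last first.
  by left; exact: subset_closure.
have [gx|gx _] := eqVneq (g x) 0; last by right; exact: subset_closure.
by rewrite (_ : (k *: f + g) x = k * f x + g x)// fx gx mulr0 addr0 eqxx.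
Qed.

Lemma Cc_mull f g : continuous g -> Cc f -> Cc (fun x => g x * f x).
Proof.
move=> cg [cf Kf]; apply: (Cc_of_compact _ Kf) => [x|x].
  by apply: cvgM; [exact: cg|exact: cf].
have [->|fx _] := eqVneq (f x) 0; first by rewrite mulr0 eqxx.
exact: subset_closure.
Qed.

Lemma Cc_comp (S : topologicalType) (u : T -> S) (v : S -> T)
    (f : S -> R[i]) : continuous u -> continuous v -> cancel u v ->
  Cc f -> Cc (f \o u).
Proof.
move=> cu cv uK [cf Kf]; apply: (@Cc_of_compact _ (v @` closure [set x | f x != 0])).
- exact: continuous_compose cu cf.
- by apply: continuous_compact => //; exact: continuous_subspaceT.
- by move=> x fx; exists (u x) => //; exact: subset_closure.
Qed.

End compact_support.

Section complex_continuity.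
Context {R : realType}.

Lemma Re_continuous : continuous (@complex.Re R).
Proof.
move=> z; have FF := @nbhs_filter R[i] z; apply/cvgrPdist_lt => e e0.
have e0' : 0 < e%:C :> R[i] by rewrite ltcR.
have := nbhsx_ballx z _ e0'.
apply: filterS => w; rewrite -ball_normE -ltcR; apply: le_lt_trans.
by rewrite -raddfB normRe_le.
Qed.

Lemma Im_continuous : continuous (@complex.Im R).
Proof.
move=> z; have FF := @nbhs_filter R[i] z; apply/cvgrPdist_lt => e e0.
have e0' : 0 < e%:C :> R[i] by rewrite ltcR.
have := nbhsx_ballx z _ e0'.
apply: filterS => w; rewrite -ball_normE -ltcR; apply: le_lt_trans.
by rewrite -raddfB normIm_le.
Qed.

Lemma conjc_continuous : continuous (@conjc R : R[i] -> R[i]).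
Proof.
move=> z; have FF := @nbhs_filter R[i] z; apply/cvgrPdist_lt => e e0.
have := nbhsx_ballx z _ e0.
by apply: filterS => w; rewrite -ball_normE /= -rmorphB /= normcJ.
Qed.

Lemma real_complex_continuous : continuous (fun x : R => x%:C).
Proof.
move=> z; apply/cvgrPdist_lt => _ /ltc0_real[e e0 ->].
have := nbhsx_ballx z _ e0.
apply: filterS => w; rewrite -ball_normE /= -rmorphB /= -ltcR.
suff -> : `|z - w|%:C = `|(z - w)%:C| :> R[i] by [].
by rewrite normc_def /= expr0n /= addr0 sqrtr_sqr.
Qed.

End complex_continuity.

Section c0_transport.
Context {R : realType}.

(** The left inverse [v] provides properness: if [a] is small off [K], then a o u is small off
    v(K). *)
Lemma c0_comp_exists (X X' : topologicalType) (u : X' -> X) (v : X -> X') :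
  continuous u -> continuous v -> cancel u v ->
  exists al : c0 R X -> c0 R X', star_hom al /\ forall a x, al a x = a (u x).
Proof.
move=> cu cv uK.
have P (a : c0 R X) : (fun x => a (u x)) \in @c0_pred R X'.
  rewrite inE; split; first exact: continuous_compose cu (@c0_continuous _ _ a).
  move=> e e0; have [K cK aK] := c0_vanish a e0; exists (v @` K).
    by apply: continuous_compact => //; exact: continuous_subspaceT.
  by move=> x nKx; apply: aK => Kx; apply: nKx; exists (u x).
exists (fun a => C0 (P a)); split => //; split.
- by move=> k a b; apply: c0_ext.
- by move=> a b; apply: c0_ext.
- by move=> a; apply: c0_ext.
Qed.

End c0_transport.

Section quiver_isomorphism.
Context {R : realType}.

Record quiver_iso (Q Q' : topological_quiver R)
    (phi : vertex Q -> vertex Q') (phi' : vertex Q' -> vertex Q)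
    (psi : edge Q -> edge Q') (psi' : edge Q' -> edge Q) (h : vertex Q -> R) :
    Prop := QuiverIso {
  qi_phiK : cancel phi phi';
  qi_phi'K : cancel phi' phi;
  qi_psiK : cancel psi psi';
  qi_psi'K : cancel psi' psi;
  qi_phi : continuous phi;
  qi_phi' : continuous phi';
  qi_psi : continuous psi;
  qi_psi' : continuous psi';
  qi_gt0 : forall y, 0 < h y;
  qi_src : forall e, src (psi e) = phi (src e);
  qi_rng : forall e, rng (psi e) = phi (rng e);
  qi_lam : forall y B, borel B ->
    lam (phi y) B = ((h y)%:E * lam y (psi @^-1` B))%E
}.

(** The density is constant on each fibre measure, so its integral against the image measure is a
    plain multiple of that measure. *)
Lemma quiver_isomorphicP (Q Q' : topological_quiver R) :
  quiver_isomorphic Q Q' ->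
  exists phi phi' psi psi' h, @quiver_iso Q Q' phi phi' psi psi' h.
Proof.
move=> [phi [psi [h [[phi' [phiK phi'K cphi cphi']] [hpsi _ _] h0 sr la]]]].
have [psi' [psiK psi'K cpsi cpsi']] := hpsi.
exists phi, phi', psi, psi', h; split => //.
- by move=> e; have [] := sr e.
- by move=> e; have [] := sr e.
move=> y B bB; rewrite la//.
have [[t' _]|nT'] := pselect (exists t' : edge Q', True); last first.
  rewrite /borel_integral; case: pselect => [ht'|_]; first by case: nT'.
  suff -> : psi @^-1` B = set0 by rewrite radon0 mule0.
  by apply/seteqP; split => // e; case: nT'; exists (psi e).
have [t0' ->] := borel_integralE (fun C => lam y (psi @^-1` C)) B
  (fun=> (h y)%:E) t'.
pose t0 := psi' t0'.
have mpsi : measurable_fun [set: borel_at t0] (psi : borel_at t0 -> borel_at t0').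
  by move=> _ C mC; rewrite setTI; exact: borel_preimage.
have mB : measurable (B : set (borel_at t0')) by [].
have mpB : measurable (psi @^-1` B : set (borel_at t0)) by exact: borel_preimage.
have := @ge0_integral_pushforward _ _ (borel_at t0) (borel_at t0') R psi mpsi
  (lam y : {measure set (borel_at t0) -> \bar R}) B (cst (h y)%:E) mB
  (measurable_cst _).
move=> e; rewrite [LHS]e; last by move=> x _; rewrite lee_fin ltW.
by rewrite integral_cst.
Qed.

Lemma quiver_iso_sym (Q Q' : topological_quiver R) phi phi' psi psi' h :
  @quiver_iso Q Q' phi phi' psi psi' h ->
  @quiver_iso Q' Q phi' phi psi' psi (fun y => (h (phi' y))^-1).
Proof.
move=> [phiK phi'K psiK psi'K cphi cphi' cpsi cpsi' h0 s r l]; split => //.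
- by move=> y; rewrite invr_gt0.
- by move=> e; rewrite -{2}(psi'K e) s phiK.
- by move=> e; rewrite -{2}(psi'K e) r phiK.
move=> y B bB; rewrite -{3}(phi'K y) l; last exact: borel_preimage.
have -> : psi @^-1` (psi' @^-1` B) = B.
  by apply/seteqP; split => e /=; rewrite psiK.
by rewrite muleA -EFinM mulVf ?mul1e// gt_eqF.
Qed.

End quiver_isomorphism.

(** * Continuity of the density and the rescaling of compactly supported functions *)

Section intertwining.
Context {R : realType}.

Lemma borel_integralZl (T : topologicalType) (mu : radon_measure R T)
    (c : R) (f : T -> R) : 0 < c -> continuous f -> (forall x, 0 <= f x) ->
  borel_integral mu setT (fun x => (c * f x)%:E) =
  (c%:E * borel_integral mu setT (EFin \o f))%E.
Proof.
move=> c0 cf f0; rewrite /borel_integral; case: pselect => [ht|_]; last first.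
  by rewrite mule0.
set t0 := projT1 _; rewrite -ge0_integralZl_EFin//; last 2 first.
- by apply/measurable_EFinP; exact: continuous_borel_measurable.
- exact: ltW.
- by move=> x _; rewrite lee_fin.
Qed.

Lemma eq_borel_integral (T : topologicalType) (mu : radon_measure R T) (D : set T)
    (f g : T -> \bar R) : (forall x, D x -> f x = g x) ->
  borel_integral mu D f = borel_integral mu D g.
Proof.
move=> fg; rewrite /borel_integral; case: pselect => // ht.
by apply: eq_integral => x; rewrite inE => /fg.
Qed.

Section rescaling.
Context (Q Q' : topological_quiver R).
Context (phi : vertex Q -> vertex Q') (phi' : vertex Q' -> vertex Q).
Context (psi : edge Q -> edge Q') (psi' : edge Q' -> edge Q).
Context (h : vertex Q -> R).
Hypothesis qi : quiver_iso phi phi' psi psi' h.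
Let cphi : continuous phi. Proof. by case: qi. Qed.
Let cpsi : continuous psi. Proof. by case: qi. Qed.
Let cpsi' : continuous psi'. Proof. by case: qi. Qed.

(* Near [rng e], the density [h] is the quotient of two continuous functions:
   the integrals of a bump function at [e] against [lam (phi y)] and [lam y]. *)
Lemma density_continuous_at (e : edge Q) : {for rng e, continuous h}.
Proof.
have hE : hausdorff_space (edge Q) := @edge_hausdorff R Q.
have [f [cf f01 fe Kf]] := @bump_function R _ e (@edge_locally_compact R Q) hE.
have f0 x : 0 <= f x by case/andP: (f01 x).
pose F x := (f x)%:C.
have CF : Cc F.
  split; first exact: continuous_compose cf (@real_complex_continuous R).
  suff -> : [set x | F x != 0] = [set x | f x != 0] by [].
  by apply/seteqP; split => x /=; rewrite eq_complex /= eqxx andbT.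
have CF' := Cc_comp (@edge_hausdorff R Q') cpsi'
  cpsi (qi_psi'K qi) CF.
pose J y := complex.Re (complex_integral (lam y) setT F).
pose J' y := complex.Re (complex_integral (lam (phi y)) setT (F \o psi')).
have cJ : continuous J.
  exact: continuous_compose (lam_Cc CF).1 (@Re_continuous R).
have cJ' : continuous J'.
  apply: continuous_compose (@Re_continuous R).
  exact: continuous_compose cphi (lam_Cc CF').1.
(* The edge [e] lies in its own fibre, which is the support of [lam (rng e)]; this makes the
   denominator positive. *)
have J0 : 0 < J (rng e).
  apply: (@bump_integral R _ _ e _ hE) => //.
  by rewrite lam_support.
have JJ' y : J' y = h y * J y.
  rewrite /J' /J /= (@borel_integral_change _ _ _ _ (lam (phi y)) psi psi' (h y)
    setT (f \o psi') cpsi (qi_gt0 qi y)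
    (fun B => @qi_lam _ _ _ _ _ _ _ _ qi y B)); last 2 first.
  - exact: closed_borel closedT.
  - exact: continuous_compose cpsi' cf.
  rewrite preimage_setT.
  under [X in fine X]eq_borel_integral do rewrite /= (qi_psiK qi).
  rewrite borel_integralZl// ?(qi_gt0 qi)//.
  have h0 := qi_gt0 qi y.
  (* An infinite integral stays infinite after multiplication by h(y) > 0, and [fine] sends it to 0
     on both sides. *)
  case: (borel_integral _ _ _) => [r||] //=.
    by rewrite gt0_muley ?lte_fin//= mulr0.
  by rewrite gt0_muleNy ?lte_fin//= mulr0.
have hJ : \forall y \near rng e, J' y / J y = h y.
  have := @cvgr_gt R _ _ (nbhs_filter (rng e)) J _ (cJ (rng e)) 0 J0.
  by apply: filterS => y Jy; rewrite JJ' mulfK// gt_eqF.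
have : (J' \* (fun y => (J y)^-1)) @ nbhs (rng e) --> h (rng e).
  have -> : h (rng e) = J' (rng e) / J (rng e).
    by rewrite JJ' mulfK// gt_eqF.
  apply: cvgM; first exact: cJ'.
  by apply: cvgV; [rewrite gt_eqF|exact: cJ].
apply: cvg_trans; apply: near_eq_cvg.
exact: hJ.
Qed.

Lemma density_continuous : continuous (h \o rng).
Proof.
move=> e; apply: continuous_comp; first exact: rng_continuous.
exact: density_continuous_at.
Qed.

Definition rescale (f : edge Q -> R[i]) : edge Q' -> R[i] :=
  fun x => f (psi' x) * ((Num.sqrt (h (rng (psi' x))))^-1)%:C.

Lemma sqrt_density_neq0 y : Num.sqrt (h y) != 0.
Proof. by rewrite gt_eqF// sqrtr_gt0 (qi_gt0 qi). Qed.

Lemma rescale_continuous_factor :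
  continuous (fun x => ((Num.sqrt (h (rng (psi' x))))^-1)%:C).
Proof.
have cr : continuous (fun x => (Num.sqrt (h (rng (psi' x))))^-1).
  move=> x; apply: cvgV; first exact: sqrt_density_neq0.
  have cs := continuous_compose density_continuous (@sqrt_continuous R).
  exact: (continuous_compose cpsi' cs).
exact: (continuous_compose cr (@real_complex_continuous R)).
Qed.

Lemma rescale_linear : linear rescale.
Proof.
by move=> k f g; apply/funext => x; rewrite /rescale mulrDl -scalerAl.
Qed.

Lemma rescale_Cc f : Cc f -> Cc (rescale f).
Proof.
move=> Cf; have Cfpsi := Cc_comp (@edge_hausdorff R Q') cpsi' cpsi (qi_psi'K qi) Cf.
have := Cc_mull (@edge_hausdorff R Q') rescale_continuous_factor Cfpsi.
by congr Cc; apply/funext => x; rewrite /rescale mulrC.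
Qed.

(** Here [p] stands for the real or the imaginary part. On the fibre over [y] the two rescaling
    factors multiply to 1/h(y), which cancels the h(y) produced by the change of variables. *)
Lemma borel_integral_rescale (p : R[i] -> R) f g y : continuous p ->
  (forall z (c : R), p (z * c%:C) = p z * c) -> Cc f -> Cc g ->
  borel_integral (lam (phi y)) (rng @^-1` [set phi y])
    (fun x => (p ((rescale f x)^*%C * rescale g x))%:E) =
  borel_integral (lam y) (rng @^-1` [set y])
    (fun x => (p ((f x)^*%C * g x))%:E).
Proof.
move=> cp pZ Cf Cg; have [cWf _] := rescale_Cc Cf; have [cWg _] := rescale_Cc Cg.
rewrite (@borel_integral_change _ _ _ _ (lam (phi y)) psi psi' (h y)
    _ (fun x => p ((rescale f x)^*%C * rescale g x)) cpsi (qi_gt0 qi y)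
    (fun B => @qi_lam _ _ _ _ _ _ _ _ qi y B)); last 2 first.
- apply: closed_borel; apply: preimage_closed.
    by move=> x _; exact: rng_continuous.
  apply: accessible_closed_set1; apply: hausdorff_accessible.
  exact: vertex_hausdorff.
- apply: continuous_compose cp => x; apply: cvgM; last exact: cWg.
  exact: continuous_compose cWf (@conjc_continuous R) x.
have -> : psi @^-1` (rng @^-1` [set phi y]) = rng @^-1` [set y].
  apply/seteqP; split => x /=; rewrite (qi_rng qi); last by move=> ->.
  by move/(can_inj (qi_phiK qi)).
apply: eq_borel_integral => x /= xy; congr EFin.
rewrite /rescale (qi_psiK qi) xy.
set s := Num.sqrt (h y).
have -> : ((f x * (s^-1)%:C)^*)%C * (g x * (s^-1)%:C) =
    ((f x)^*)%C * g x * ((s ^+ 2)^-1)%:C.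
  have -> : ((f x * (s^-1)%:C)^*)%C = ((f x)^*)%C * (s^-1)%:C.
    by rewrite -[in RHS](conjc_real s^-1); exact: rmorphM.
  rewrite mulrACA -realcM; congr (_ * _%:C).
  by rewrite -invfM.
rewrite pZ sqr_sqrtr ?(ltW (qi_gt0 qi y))// mulrCA mulfV ?mulr1//.
by rewrite gt_eqF// (qi_gt0 qi).
Qed.

Lemma complex_integral_rescale f g y : Cc f -> Cc g ->
  complex_integral (lam (phi y)) (rng @^-1` [set phi y])
    (fun x => (rescale f x)^*%C * rescale g x) =
  complex_integral (lam y) (rng @^-1` [set y]) (fun x => (f x)^*%C * g x).
Proof.
move=> Cf Cg; rewrite /complex_integral !borel_integral_rescale//.
- exact: Im_continuous.
- by move=> [a b] c /=; rewrite mulr0 add0r.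
- exact: Re_continuous.
- by move=> [a b] c /=; rewrite mulr0 subr0.
Qed.

End rescaling.
End intertwining.

Section correspondence_of_isomorphic_quivers.
Context {R : realType}.

Lemma rescaleK (Q Q' : topological_quiver R) phi phi' psi psi' h :
  @quiver_iso R Q Q' phi phi' psi psi' h ->
  cancel (rescale psi' h) (rescale psi (fun y => (h (phi' y))^-1)).
Proof.
move=> qi f; apply/funext => e.
rewrite /rescale (qi_psiK qi) (qi_rng qi) (qi_phiK qi).
rewrite sqrtrV ?(ltW (qi_gt0 qi _))// invrK -mulrA -realcM mulVf ?mulr1//.
exact: sqrt_density_neq0 qi _.
Qed.

Lemma quiver_iso_corr_iso (Q Q' : topological_quiver R)
    (EQ : quiver_correspondence Q) (EQ' : quiver_correspondence Q')
    phi phi' psi psi' h :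
  @quiver_iso R Q Q' phi phi' psi psi' h ->
  exists al be (U : EQ -> EQ') (V : EQ' -> EQ), corr_iso al be U V.
Proof.
move=> qi; have iq := quiver_iso_sym qi.
have [phiK phi'K psiK psi'K cphi cphi' cpsi cpsi' _ qs qr _] := qi.
have [al [hal alE]] := @c0_comp_exists R _ _ _ _ cphi' cphi phi'K.
have [be [hbe beE]] := @c0_comp_exists R _ _ _ _ cphi cphi' phiK.
exists al, be.
apply: (@corr_iso_of_dense R _ _ EQ EQ' al be (edge Q -> R[i]) (edge Q' -> R[i])
  (@Cc R (edge Q)) (@Cc R (edge Q')) (@quiver_incl R Q EQ) (@quiver_incl R Q' EQ')
  (rescale psi' h) (rescale psi (fun y => (h (phi' y))^-1))) => //.
- by move=> a; apply: c0_ext => x; rewrite beE alE phiK.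
- by move=> a; apply: c0_ext => x; rewrite alE beE phi'K.
- exact: quiver_incl_dense.
- exact: quiver_incl_dense.
- exact: Cc_linear (@edge_hausdorff R Q).
- exact: Cc_linear (@edge_hausdorff R Q').
- exact: quiver_incl_linear.
- exact: quiver_incl_linear.
- exact: rescale_linear.
- exact: rescale_linear.
- exact: rescaleK qi.
(* Inverting twice produces the density 1/(1/h(phi'(phi y))), which must be identified with [h]. *)
- have := rescaleK iq; congr cancel; congr rescale.
  by apply/funext => y; rewrite phiK invrK.
- exact: rescale_Cc qi.
- exact: rescale_Cc iq.
- move=> f g Cf Cg; apply: c0_ext => y; rewrite alE.
  have [Wf Wg] := (rescale_Cc qi Cf, rescale_Cc qi Cg).
  rewrite !quiver_incl_inner//.
  by rewrite -(complex_integral_rescale qi)// phi'K.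
- move=> a f Cf; exists (fun e => a (src e) * f e).
    apply: Cc_mull => //; first exact: edge_hausdorff.
    exact: continuous_compose (@src_continuous _ _) (@c0_continuous _ _ a).
  have Wf := rescale_Cc qi Cf; rewrite !quiver_incl_lact//.
  split => //; congr quiver_incl; apply/funext => x.
  by rewrite /rescale alE mulrA -{1}(psi'K x) qs phiK.
Qed.

End correspondence_of_isomorphic_quivers.

Theorem corollary2p23 (R : realType) (Q Q' : topological_quiver R)
    (EQ : quiver_correspondence Q) (EQ' : quiver_correspondence Q') :
  quiver_isomorphic Q Q' ->
  (forall (TQ : toeplitz_pimsner EQ) (TQ' : toeplitz_pimsner EQ'),
     cstar_isomorphic TQ TQ') /\
  (forall (CQ : cuntz_pimsner EQ) (CQ' : cuntz_pimsner EQ'),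
     cstar_isomorphic CQ CQ').
Proof.
move=> /quiver_isomorphicP[phi [phi' [psi [psi' [h qi]]]]].
have [al [be [U [V iso]]]] := quiver_iso_corr_iso EQ EQ' qi.
have isos := corr_iso_sym iso.
split=> [TQ TQ'|CQ CQ'].
  apply: (@cuntz_pimsner_isomorphic _ _ _ _ _ _ _ _ _ _ _ TQ TQ' iso) => _ ->.
    by have [la _ _] := ci_al iso; exact: linear_map0.
  by have [la _ _] := ci_be iso; exact: linear_map0.
apply: (@cuntz_pimsner_isomorphic _ _ _ _ _ _ _ _ _ _ _ CQ CQ' iso) => a.
  exact: corr_iso_katsura iso.
exact: corr_iso_katsura isos.
Qed.
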